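(* Let $R$ be a non-discrete irreducible, continuous ring. Then the projective unit group $\mathrm{PGL}(R) = \mathrm{GL}(R)/\mathrm{Z}(\mathrm{GL}(R))$ is a simple group.
   Context: All rings are associative and unital. A ring $R$ is (von Neumann) regular if for every $a \in R$ there is $b \in R$ with $aba = a$. For a regular ring $R$, the set $\mathrm{L}(R) = \{ aR \mid a \in R \}$ of principal right ideals, ordered by inclusion, is a complemented modular lattice. A continuous ring is a regular ring $R$ such that the lattice $\mathrm{L}(R)$ is complete and satisfies $I \wedge \bigvee C = \bigvee \{ I \wedge J \mid J \in C\}$ and $I \vee \bigwedge C = \bigwedge \{ I \vee J \mid J \in C\}$ for every chain $C \subseteq \mathrm{L}(R)$ and every $I \in \mathrm{L}(R)$. A ring is irreducible if it is non-zero and not isomorphic to a direct product of two non-zero rings. $\mathrm{E}(R) = \{ e \in R \mid e^2 = e \}$; $e,f \in \mathrm{E}(R)$ are orthogonal if $ef=fe=0$. A rank function on a regular ring $R$ is a map $\rho \colon R \to [0,1]$ such that $\rho(1)=1$; $\rho(ab) \leq \min\{\rho(a),\rho(b)\}$ for all $a,b \in R$; $\rho(e+f) = \rho(e)+\rho(f)$ for orthogonal $e,f \in \mathrm{E}(R)$; and $\rho(a) > 0$ for all $a \in R \setminus \{0\}$. By von Neumann, every irreducible, continuous ring $R$ admits a unique rank function, denoted $\mathrm{rk}_R$, and $d_R(a,b) = \mathrm{rk}_R(a-b)$ is a (complete) metric on $R$. The ring $R$ is called discrete if the topology on $R$ generated by $d_R$ is discrete, and non-discrete otherwise. $\mathrm{GL}(R)$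 is the group of (multiplicatively invertible) units of $R$, and $\mathrm{Z}(G)$ denotes the center of a group $G$. *)

(* Defs.v *)
From HB Require Import structures.
From mathcomp Require Import all_boot all_order all_algebra.
From mathcomp Require Import boolp classical_sets reals.

Set Implicit Arguments.
Unset Strict Implicit.
Unset Printing Implicit Defensive.

Import Order.TTheory GRing.Theory Num.Theory.

Local Open Scope classical_set_scope.
Local Open Scope ring_scope.

Definition regular_ring (R : pzRingType) : Prop :=
  forall a : R, exists b : R, a * b * a = a.

Section PrincipalRightIdeals.
Variable R : pzRingType.

Definition rideal (a : R) : set R := [set a * x | x in [set: R]].

Definition is_rideal (I : set R) : bool := `[< exists a, I = rideal a >].

Record pideal := PIdeal { pideal_set :> set R; _ : is_rideal pideal_set }.

HB.instance Definition _ := [isSub for pideal_set].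
HB.instance Definition _ := [Choice of pideal by <:].

Definition le_pideal (I J : pideal) : bool :=
  `[< pideal_set I `<=` pideal_set J >].

Fact le_pideal_refl : reflexive le_pideal.
Proof. by move=> I; apply/asboolP. Qed.

Fact le_pideal_anti : antisymmetric le_pideal.
Proof.
move=> I J /andP[/asboolP IJ /asboolP JI].
by apply/val_inj; rewrite eqEsubset.
Qed.

Fact le_pideal_trans : transitive le_pideal.
Proof.
move=> J I K /asboolP IJ /asboolP JK; apply/asboolP; exact: subset_trans JK.
Qed.

Fact pideal_display : Order.disp_t. Proof. exact: Order.Disp tt tt. Qed.

HB.instance Definition _ := Order.Le_isPOrder.Build pideal_display pideal
  le_pideal_refl le_pideal_anti le_pideal_trans.

Fact is_rideal_rideal a : is_rideal (rideal a).
Proof. by apply/asboolP; exists a. Qed.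

Definition principal (a : R) : pideal := PIdeal (is_rideal_rideal a).

(* The default values of [supremum] and [infimum] are those of the empty family:
   the least element 0R and the greatest element 1R of L(R) = [pideal R]. *)
Definition psup (C : set pideal) : pideal := supremum (principal 0) C.
Definition pinf (C : set pideal) : pideal := infimum (principal 1) C.
Definition pjoin (I J : pideal) : pideal := psup [set I; J].
Definition pmeet (I J : pideal) : pideal := pinf [set I; J].

Definition complete_pideals : Prop :=
  forall C : set pideal, supremums C !=set0 /\ infimums C !=set0.

Definition pideal_chain (C : set pideal) : Prop :=
  total_on C (fun I J => (I <= J)%O).

Definition continuous_ring : Prop :=
  [/\ regular_ring R,
      complete_pideals,
      forall (C : set pideal) (I : pideal), pideal_chain C ->
        pmeet I (psup C) = psup [set pmeet I J | J in C]
    & forall (C : set pideal) (I : pideal), pideal_chain C ->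
        pjoin I (pinf C) = pinf [set pjoin I J | J in C]].

End PrincipalRightIdeals.

Definition irreducible_ring (R : pzRingType) : Prop :=
  (1 : R) <> 0 /\
  ~ (exists (S T : nzRingType) (f : {rmorphism R -> (S * T)%type}),
       bijective f).

Section RankFunctions.
Variables (R : pzRingType) (K : realType).

Definition idempotent (e : R) : Prop := e * e = e.

Definition orthogonal (e f : R) : Prop := e * f = 0 /\ f * e = 0.

Record rank_function (rho : R -> K) : Prop := {
  rank_bounds : forall a, 0 <= rho a <= 1;
  rank1 : rho 1 = 1;
  rankM : forall a b, rho (a * b) <= Num.min (rho a) (rho b);
  rankD : forall e f, idempotent e -> idempotent f -> orthogonal e f ->
    rho (e + f) = rho e + rho f;
  rank_gt0 : forall a, a <> 0 -> 0 < rho a }.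

Definition rank_dist (rho : R -> K) (a b : R) : K := rho (a - b).

Definition rank_open (rho : R -> K) (A : set R) : Prop :=
  forall a, A a -> exists2 r : K, 0 < r & [set b | rank_dist rho a b < r] `<=` A.

(* A rank function on an irreducible continuous ring is unique, so there this
   is a property of the ring: discreteness of the topology of d_R. *)
Definition rank_discrete (rho : R -> K) : Prop :=
  forall A : set R, rank_open rho A.

End RankFunctions.

Section Groups.
Local Open Scope group_scope.

Record is_normal (G : groupType) (N : set G) : Prop := {
  normal1 : N 1;
  normalM : forall x y, N x -> N y -> N (x * y);
  normalV : forall x, N x -> N x^-1;
  normalJ : forall x y, N x -> N (y^-1 * x * y) }.

Definition simple_group (G : groupType) : Prop :=
  (exists x : G, x <> 1) /\
  forall N : set G, is_normal N -> N = [set 1] \/ N = [set: G].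

Definition center (G : groupType) : set G :=
  [set z | forall x : G, z * x = x * z].

Fact center_normal (G : groupType) : is_normal (@center G).
Proof.
split=> [x | x y Zx Zy z | x Zx z | x y Zx z].
- by rewrite mul1g mulg1.
- by rewrite -mulgA (Zy z) !mulgA (Zx z).
- by apply: (mulgI x); rewrite mulVKg mulgA (Zx z) mulgK.
- by rewrite -(mulgA _ x) Zx mulKg Zx.
Qed.

Section Quotient.
Variables (G : groupType) (N : set G) (nN : is_normal N).

Definition coset_rel : rel G := fun x y => `[< N (x^-1 * y) >].

Fact coset_rel_refl : reflexive coset_rel.
Proof. by move=> x; apply/asboolP; rewrite mulVg; exact: normal1 nN. Qed.

Fact coset_rel_sym : symmetric coset_rel.
Proof.
move=> x y; apply/asboolP/asboolP => /(normalV nN); by rewrite invgM invgK.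
Qed.

Fact coset_rel_trans : transitive coset_rel.
Proof.
move=> y x z /asboolP xy /asboolP yz; apply/asboolP.
by have := normalM nN xy yz; rewrite mulgA mulgK.
Qed.

Definition coset_equiv : equiv_rel G :=
  EquivRel coset_rel coset_rel_refl coset_rel_sym coset_rel_trans.

Definition quotient_group : Type := {eq_quot coset_equiv}%qT.

HB.instance Definition _ := Choice.on quotient_group.
HB.instance Definition _ := Quotient.on quotient_group.

Definition coset (x : G) : quotient_group := (\pi_(quotient_group) x)%qT.

Fact coset_eqP x y : coset x = coset y <-> N (x^-1 * y).
Proof. by split=> [/eqquotP/asboolP | H]; [|apply/eqquotP/asboolP]. Qed.

Definition quot_one : quotient_group := coset 1.
Definition quot_inv (u : quotient_group) : quotient_group :=
  coset (repr u)^-1.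
Definition quot_mul (u v : quotient_group) : quotient_group :=
  coset (repr u * repr v).

Fact cosetV x : quot_inv (coset x) = coset x^-1.
Proof.
apply/coset_eqP; rewrite invgK.
have /coset_eqP H : coset x = coset (repr (coset x)) by rewrite /coset reprK.
have := normalJ nN x^-1 H; rewrite invgK mulgA mulgV mul1g.
by [].
Qed.

Fact cosetM x y : quot_mul (coset x) (coset y) = coset (x * y).
Proof.
apply/esym/coset_eqP; set x' := repr _; set y' := repr _.
have /coset_eqP Hx : coset x = coset x' by rewrite /coset reprK.
have /coset_eqP Hy : coset y = coset y' by rewrite /coset reprK.
have := normalM nN (normalJ nN y Hx) Hy.
by rewrite invgM !mulgA mulgK.
Qed.

Fact quot_mulA : associative quot_mul.
Proof.
elim/quotW=> x; elim/quotW=> y; elim/quotW=> z.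
by rewrite -!/(coset _) !cosetM mulgA.
Qed.

Fact quot_mul1 : left_id quot_one quot_mul.
Proof. by elim/quotW=> x; rewrite -/(coset _) cosetM mul1g. Qed.

Fact quot_1mul : right_id quot_one quot_mul.
Proof. by elim/quotW=> x; rewrite -/(coset _) cosetM mulg1. Qed.

Fact quot_mulV : left_inverse quot_one quot_inv quot_mul.
Proof. by elim/quotW=> x; rewrite -/(coset _) cosetV cosetM mulVg. Qed.

Fact quot_Vmul : right_inverse quot_one quot_inv quot_mul.
Proof. by elim/quotW=> x; rewrite -/(coset _) cosetV cosetM mulgV. Qed.

HB.instance Definition _ := isGroup.Build quotient_group
  quot_mulA quot_mul1 quot_1mul quot_mulV quot_Vmul.

End Quotient.
End Groups.

Section UnitGroup.
Variable R : unitRingType.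

Record GL := MkGL { GLval :> R; _ : GLval \is a GRing.unit }.

HB.instance Definition _ := [isSub for GLval].
HB.instance Definition _ := [Choice of GL by <:].

Fact GLP (u : GL) : GLval u \is a GRing.unit. Proof. exact: valP u. Qed.

Fact GL_unitM (u v : GL) : GLval u * GLval v \is a GRing.unit.
Proof. by rewrite unitrMl GLP. Qed.

Fact GL_unitV (u : GL) : (GLval u)^-1 \is a GRing.unit.
Proof. by rewrite unitrV GLP. Qed.

Definition GL_one : GL := MkGL (unitr1 R).
Definition GL_inv (u : GL) : GL := MkGL (GL_unitV u).
Definition GL_mul (u v : GL) : GL := MkGL (GL_unitM u v).

Fact GL_mulA : associative GL_mul.
Proof. by move=> u v w; apply/val_inj; exact: mulrA. Qed.

Fact GL_mul1 : left_id GL_one GL_mul.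
Proof. by move=> u; apply/val_inj; exact: mul1r. Qed.

Fact GL_1mul : right_id GL_one GL_mul.
Proof. by move=> u; apply/val_inj; exact: mulr1. Qed.

Fact GL_mulV : left_inverse GL_one GL_inv GL_mul.
Proof. by move=> u; apply/val_inj; exact: (mulVr (GLP u)). Qed.

Fact GL_Vmul : right_inverse GL_one GL_inv GL_mul.
Proof. by move=> u; apply/val_inj; exact: (mulrV (GLP u)). Qed.

HB.instance Definition _ := isGroup.Build GL
  GL_mulA GL_mul1 GL_1mul GL_mulV GL_Vmul.

Definition PGL : groupType := quotient_group (center_normal GL).

End UnitGroup.

(* Main.v *)
Require Import Defs.
From Stdlib Require Ncring Ncring_tac.
From HB Require Import structures.
From mathcomp Require Import all_boot all_order all_algebra.
From mathcomp Require Import boolp classical_sets reals.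
From mathcomp Require Import lra.

(* The transvections [1 + n], [n^2 = 0], generate [GL(R)], and every noncentral
   normal subgroup contains all of them.

   Comparability of idempotents and the halving [e = p + q], [p ~ q], come from a
   maximal partial isomorphism between right ideals, which Zorn's lemma provides
   because upper continuity keeps "graph of an isomorphism" stable under suprema
   of chains. Together with the rank function this gives [rk e = rk f -> e ~ f],
   hence unit-regularity of every corner.

   Generation. For [e ~ f] elementary operations reduce a unit of the corner of
   [e + f] to one of the corner of [f]; with Whitehead's lemma a unit [g_n] of the
   corner [e_n] equals [x_n g_(n+1)], where [x_n] is a product of a bounded number
   of transvections and [g_(n+1)] lives in an orthogonal corner of half the rank.
   As the [g_n] commute, [g_0 = (x_0 x_2 ...) (x_1 x_3 ...)], and each infinite
   product is again a product of boundedly many transvections because square-zero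
   elements of orthogonal corners can be summed.

   Normal subgroups. If [g] in [N] is not central then [(1 - e) g e <> 0] for some
   [e] of small rank, and for a suitable [n] in [e R] the commutator of [g] and
   [1 + n] is a transvection. The [x] in [f R (1 - f)] with [1 + x] in [N] form a
   bimodule, since corners are generated by square-zero elements; as [R] is simple
   this bimodule is [0] or everything, and conjugation of square-zero elements of
   equal rank carries the conclusion from one [f] to all others. *)

Set Implicit Arguments.
Unset Strict Implicit.
Unset Printing Implicit Defensive.

Import Order.TTheory GRing.Theory Num.Theory.

Local Open Scope ring_scope.

(** * A normalisation tactic for noncommutative rings *)

#[local] Instance nc_ops (R : pzRingType) :
  @Ncring.Ring_ops R 0 1 +%R *%R (fun x y => x - y) -%R eq := {}.
#[local] Instance nc_ring (R : pzRingType) : Ncring.Ring (Ro := nc_ops R).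
Proof.
split; rewrite //=; try exact _.
- exact: add0r.
- exact: addrC.
- exact: addrA.
- exact: mul1r.
- exact: mulr1.
- exact: mulrA.
- exact: mulrDl.
- by move=> x y z; exact: mulrDr.
- exact: subrr.
Qed.

Ltac nc := Ncring_tac.non_commutative_ring.

Definition mul_expand (R : pzRingType) :=
  (@mulrDl R, @mulrDr R, @mulrBl R, @mulrBr R, @mulNr R, @mulrN R, @mul1r R,
   @mulr1 R, @mul0r R, @mulr0 R, @mulrA R, @oppr0 R).

(** * Idempotents and isomorphisms between their right ideals *)

Section Idempotents.
Variable R : pzRingType.
Implicit Types a b c d e f p q w x y z : R.

(** Expanded products associate to the left, which hides [a * b] behind a prefix [x]; in this form a
    relation can rewrite there. *)
Lemma mulr_under a b c : a * b = c -> forall x, x * a * b = x * c.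
Proof. by move=> <- x; rewrite mulrA. Qed.

Definition subidem p e := [/\ p * p = p, e * p = p & p * e = p].

(** Equivalently, [p] is idempotent and [p R = a R]. *)
Definition generates p a := p * a = a /\ exists z, p = a * z.

(** This is the condition for [a x -> b x] to be a well-defined isomorphism from [a R] onto
    [b R]. *)
Definition same_rann a b := forall z, a * z = 0 <-> b * z = 0.

(** Murray-von Neumann equivalence with its witnesses: left multiplication by [w] maps [e R] onto
    [f R], with inverse [w']. *)
Definition iso_pair e f w w' :=
  [/\ f * w = w, w * e = w, e * w' = w' & w' * f = w'] /\
  (w' * w = e /\ w * w' = f).

Definition idem_equiv e f := exists w w', iso_pair e f w w'.

Lemma subidemC p e : e * e = e -> subidem p e -> subidem (e - p) e.
Proof. by move=> ee [pp ep pe]; split; rewrite !mul_expand ?ee ?pp ?ep ?pe; nc. Qed.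

Lemma idemC e : e * e = e -> (1 - e) * (1 - e) = 1 - e.
Proof. by move=> ee; rewrite !mul_expand ee; nc. Qed.

Lemma idem_equiv_sym e f : idem_equiv e f -> idem_equiv f e.
Proof. by move=> [w [w' [[h1 h2 h3 h4] [h5 h6]]]]; exists w', w. Qed.

Lemma iso_pairD e f e' f' w w' v v' : e * e' = 0 -> e' * e = 0 ->
  f * f' = 0 -> f' * f = 0 -> iso_pair e f w w' -> iso_pair e' f' v v' ->
  iso_pair (e + e') (f + f') (w + v) (w' + v').
Proof.
move=> o1 o2 o3 o4 [[h1 h2 h3 h4] [h5 h6]] [[k1 k2 k3 k4] [k5 k6]].
have vw : v' * w = 0 by rewrite -h1 -k4 mulrA -(mulrA v') o4 mulr0 mul0r.
have wv : w' * v = 0 by rewrite -k1 -h4 mulrA -(mulrA w') o3 mulr0 mul0r.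
have wv' : w * v' = 0 by rewrite -h2 -k3 mulrA -(mulrA w) o1 mulr0 mul0r.
have vw' : v * w' = 0 by rewrite -k2 -h3 mulrA -(mulrA v) o2 mulr0 mul0r.
have fv : f * v = 0 by rewrite -k1 mulrA o3 mul0r.
have fw : f' * w = 0 by rewrite -h1 mulrA o4 mul0r.
have ev : e * v' = 0 by rewrite -k3 mulrA o1 mul0r.
have ew : e' * w' = 0 by rewrite -h3 mulrA o2 mul0r.
have we : w * e' = 0 by rewrite -h2 -mulrA o1 mulr0.
have ve : v * e = 0 by rewrite -k2 -mulrA o2 mulr0.
have wf : w' * f' = 0 by rewrite -h4 -mulrA o3 mulr0.
have vf : v' * f = 0 by rewrite -k4 -mulrA o4 mulr0.
by do !split; rewrite !mul_expand ?(h1, h2, h3, h4, h5, h6, k1, k2, k3, k4, k5, k6)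
  ?(vw, wv, wv', vw', fv, fw, ev, ew, we, ve, wf, vf) ?addr0 ?add0r.
Qed.

Lemma same_rann_sym a b : same_rann a b -> same_rann b a.
Proof. by move=> h z; split=> /h. Qed.

End Idempotents.

(** * Generators of right ideals in a regular ring *)

Section Regular.
Variables (R : pzRingType) (Rreg : regular_ring R).
Implicit Types a b c d e f p q w x y z : R.

Lemma generatesP e a : e * e = e -> e * a = a ->
  exists p, subidem p e /\ generates p a.
Proof.
move=> ee ea; have [b aba] := Rreg a.
exists (a * b * e); split; split.
- by rewrite !mulrA -(mulrA _ e) ea aba.
- by rewrite !mulrA ea.
- by rewrite -mulrA ee.
- by rewrite -mulrA ea.
by exists (b * e); rewrite mulrA.
Qed.

(** [a] kills [a' a - 1], hence so does [b], and [b a' a = b]. Thus left multiplication by [b a']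
    carries [a] to [b], with inverse [a b']. *)
Lemma idem_equiv_rann a b p q : same_rann a b -> p * p = p -> q * q = q ->
  generates p a -> generates q b -> idem_equiv p q.
Proof.
move=> rab pp qq [pa [z pz]] [qb [t qt]].
have [a' aa] := Rreg a; have [b' bb] := Rreg b.
have ba : b * a' * a = b.
  apply/subr0_eq; suff : b * (a' * a - 1) = 0 by rewrite mulrBr mulr1 !mulrA.
  by apply/rab; rewrite mulrBr mulr1 !mulrA aa subrr.
have ab : a * b' * b = a.
  apply/subr0_eq; suff : a * (b' * b - 1) = 0 by rewrite mulrBr mulr1 !mulrA.
  by apply/rab; rewrite mulrBr mulr1 !mulrA bb subrr.
exists (b * a' * p), (a * b' * q); do !split.
- by rewrite !mulrA qb.
- by rewrite -mulrA pp.
- by rewrite !mulrA pa.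
- by rewrite -mulrA qq.
- by rewrite !mulrA -(mulrA _ q b) qb ab pz !mulrA aa.
- by rewrite !mulrA -(mulrA _ p a) pa ba qt !mulrA bb.
Qed.

(** A Gram-Schmidt step: [p] generates [a R] and [q] generates [(1 - p) b R], so [p + q] generates
    [a R + b R]. The formula for [q] bounds its rank by that of [b]. *)
Lemma ortho_sum a b : exists p q y, [/\ p * p = p, q * q = q, p * q = 0 &
  q * p = 0] /\ [/\ generates p a, (p + q) * b = b & q = (1 - p) * b * y].
Proof.
have [p [[pp _ _] gpa]] := generatesP (mul1r 1) (mul1r a).
have ppC := idemC pp.
have h : (1 - p) * ((1 - p) * b) = (1 - p) * b by rewrite mulrA ppC.
have [q [[qq pq qp] [qb [y qy]]]] := generatesP ppC h.
have pq0 : p * q = 0 by rewrite -pq mulrA mulrBr mulr1 pp subrr mul0r.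
have qp0 : q * p = 0 by rewrite -qp -mulrA mulrBl mul1r pp subrr mulr0.
exists p, q, y; split=> //; split=> //.
by move: qb; rewrite mulrBl mul1r mulrBr mulrA qp0 mul0r subr0 mulrDl => ->;
  rewrite addrC subrK.
Qed.

Lemma ortho_gen a b : (forall x y, a * x = b * y -> a * x = 0) ->
  exists p q, [/\ p * p = p, q * q = q, p * q = 0 & q * p = 0] /\
    generates p a /\ generates q b.
Proof.
move=> ind.
have [p [[pp _ _] [pa [u pu]]]] := generatesP (mul1r 1) (mul1r a).
have [b1 b1E] : exists b1, b1 = (1 - p) * b by exists ((1 - p) * b).
have ppC := idemC pp.
have h : (1 - p) * b1 = b1 by rewrite b1E mulrA ppC.
have [q [[qq pq qp] [qb [y0 qy0]]]] := generatesP ppC h.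
have [y yE] : exists y, y = y0 * q by exists (y0 * q).
have qy : q = b1 * y by rewrite yE mulrA -qy0 qq.
have yq : y * q = y by rewrite yE -mulrA qq.
have pq0 : p * q = 0 by rewrite -pq mulrA mulrBr mulr1 pp subrr mul0r.
have qp0 : q * p = 0 by rewrite -qp -mulrA mulrBl mul1r pp subrr mulr0.
have qb1 : q * b = b1 by rewrite -[RHS]qb b1E mulrA mulrBr mulr1 qp0 subr0.
(* [q'] is an idempotent that kills [a R] and generates [b R]; subtracting [p q'] from [p] makes the
   two orthogonal. *)
have [q' q'E] : exists q', q' = b * y by exists (b * y).
have yb : y * b = y * b1 by rewrite -yq -mulrA qb1 -[y * q * b1]mulrA qb.
have q'q' : q' * q' = q'.
  by rewrite q'E mulrA -(mulrA b) yb -mulrA -(mulrA y) -qy yq.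
have q'p : q' * p = 0 by rewrite q'E -mulrA -yq -mulrA qp0 !mulr0.
exists (p - p * q'), q'; split; [split|split; split] => //.
- by rewrite !mul_expand ?(pp, mulr_under pp, mulr_under q'p, mulr_under q'q', q'p); nc.
- by rewrite !mul_expand (mulr_under q'q') subrr.
- by rewrite !mul_expand q'p mul0r subrr.
- suff : (p - p * q') * p * a = p * a by rewrite -!mulrA pa.
  by rewrite !mul_expand (mulr_under q'p) pp; nc.
- by exists (u * (1 - q')); rewrite mulrA -pu mulrBr mulr1.
- apply/subr0_eq.
  (* [q' b - b] lies in [b R] and, being killed by [1 - p], also in [a R], so independence makes it
     vanish. *)
  have E : (1 - p) * (q' * b - b) = 0.
    by rewrite mulrBr q'E !mulrA -b1E -qy qb1 subrr.
  have E2 : q' * b - b = p * (q' * b - b).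
    by apply/subr0_eq; rewrite -[RHS]E; nc.
  rewrite E2 pu -mulrA; apply: (ind _ (y * b - 1)).
  by rewrite mulrA -pu -E2 q'E mulrBr mulr1 mulrA.
- by exists y.
Qed.

Hypothesis Rcomp : complete_pideals R.

Lemma idealP a z : rideal a z <-> exists x, z = a * x.
Proof. by split=> [[x _ <-]|[x ->]]; exists x. Qed.

(* In a regular ring right annihilators of elements are principal, so
   completeness of L(R) makes right annihilators of arbitrary sets principal. *)
Lemma rann_principal (S : R -> Prop) : exists i, i * i = i /\
  forall z, i * z = z <-> forall s, S s -> s * z = 0.
Proof.
pose C : set (pideal R) := fun J => exists2 s, S s &
  forall z, pideal_set J z <-> s * z = 0.
have [_ [I [lbI gI]]] := Rcomp C.
have Iz z : pideal_set I z <-> forall s, S s -> s * z = 0.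
  split=> [Iz s Ss|h].
    have [s' ss] := Rreg s.
    have eqr x : pideal_set (principal (1 - s' * s)) x <-> s * x = 0.
      split=> [/idealP[y ->]|sx0]; last first.
        by apply/idealP; exists x; rewrite mulrBl mul1r -mulrA sx0 mulr0 subr0.
      by rewrite mulrA mulrBr mulr1 mulrA ss subrr mul0r.
    apply/eqr; have : (I <= principal (1 - s' * s)%R)%O by apply: lbI; exists s.
    by move=> /asboolP; apply.
  have : (principal z <= I)%O.
    apply: gI => J [s Ss Js]; apply/asboolP => _ /idealP[x ->].
    by apply/Js; rewrite mulrA h ?mul0r.
  by move/asboolP; apply; apply/idealP; exists 1; rewrite mulr1.
have : is_rideal (pideal_set I) by case: (I).
move=> /asboolP[a Ia].
have [p [[pp _ _] [pa [t pt]]]] := generatesP (mul1r 1) (mul1r a).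
exists p; split=> // z; rewrite -Iz Ia idealP; split=> [<-|[x ->]].
  by exists (t * z); rewrite mulrA -pt.
by rewrite mulrA pa.
Qed.

(** The intersection of [e R] and [f R] is the right annihilator of [1 - e] and [1 - f]. *)
Lemma meet_idem e f : exists i, i * i = i /\
  forall z, i * z = z <-> e * z = z /\ f * z = z.
Proof.
have [i [ii h]] := rann_principal (fun s => s = 1 - e \/ s = 1 - f).
exists i; split=> // z; rewrite h; split.
  move=> k; have /eqP := k _ (or_introl erefl).
  have /eqP := k _ (or_intror erefl).
  by rewrite !mulrBl !mul1r !subr_eq0 => /eqP <- /eqP <-.
by move=> [ez fz] s [->|->]; rewrite mulrBl mul1r ?ez ?fz subrr.
Qed.

End Regular.

(** * Primeness *)

Section CentralCorner.
Variable R : pzRingType.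

(** Bundling centrality and nonvanishing lets the corner carry a ring structure with unit [g], in
    the type of nonzero rings that [irreducible_ring] asks of the two factors. *)
Record cidem := CIdem { cidem_val : R; _ : cidem_val * cidem_val = cidem_val;
  _ : forall x, cidem_val * x = x * cidem_val; _ : cidem_val <> 0 }.

Variable g : cidem.
Let gv := cidem_val g.
Let gg : gv * gv = gv. Proof. by rewrite /gv; case: g. Qed.
Let gC x : gv * x = x * gv. Proof. by rewrite /gv; case: g. Qed.
Let g0 : gv <> 0. Proof. by rewrite /gv; case: g. Qed.

Definition corner_pred : {pred R} := fun x => cidem_val g * x == x.

Fact corner_zmod_closed : zmod_closed corner_pred.
Proof.
split=> [|x y /eqP xg /eqP yg]; first by rewrite /in_mem /= /corner_pred mulr0.
by apply/eqP; rewrite mulrBr xg yg.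
Qed.

HB.instance Definition _ :=
  GRing.isZmodClosed.Build R corner_pred corner_zmod_closed.

Record corner_ring :=
  CornerRing { corner_val : R; _ : corner_val \in corner_pred }.

HB.instance Definition _ := [isSub for corner_val].
HB.instance Definition _ := [Choice of corner_ring by <:].
HB.instance Definition _ := [SubChoice_isSubZmodule of corner_ring by <:].

Fact corner_valP (x : corner_ring) : gv * val x = val x.
Proof. by apply/eqP; exact: (valP x). Qed.

Fact corner_mulP (x y : corner_ring) : val x * val y \in corner_pred.
Proof. by apply/eqP; rewrite mulrA corner_valP. Qed.

Fact corner_projP (x : R) : gv * x \in corner_pred.
Proof. by apply/eqP; rewrite mulrA gg. Qed.

Definition corner_proj x : corner_ring := CornerRing (corner_projP x).
Definition corner_mul x y : corner_ring := CornerRing (corner_mulP x y).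

Fact corner_mulA : associative corner_mul.
Proof. by move=> x y z; apply/val_inj/mulrA. Qed.
Fact corner_mul1 : left_id (corner_proj 1) corner_mul.
Proof. by move=> x; apply/val_inj; rewrite /= mulr1 corner_valP. Qed.
Fact corner_1mul : right_id (corner_proj 1) corner_mul.
Proof. by move=> x; apply/val_inj; rewrite /= mulr1 -gC corner_valP. Qed.
Fact corner_mulDl : left_distributive corner_mul +%R.
Proof. by move=> x y z; apply/val_inj/mulrDl. Qed.
Fact corner_mulDr : right_distributive corner_mul +%R.
Proof. by move=> x y z; apply/val_inj/mulrDr. Qed.
Fact corner_1neq0 : corner_proj 1 != 0.
Proof.
by apply/eqP => /(congr1 val) /=; rewrite mulr1 => /g0.
Qed.

HB.instance Definition _ := GRing.Zmodule_isNzRing.Build corner_ring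
  corner_mulA corner_mul1 corner_1mul corner_mulDl corner_mulDr corner_1neq0.

End CentralCorner.

Section Product.
Variables (R : pzRingType) (g h : cidem R).
Hypothesis ghE : cidem_val h = 1 - cidem_val g.

Definition corner_pair (x : R) : (corner_ring g * corner_ring h)%type :=
  (corner_proj g x, corner_proj h x).

Fact corner_pair_zmod : zmod_morphism corner_pair.
Proof.
by move=> x y; congr pair; apply/val_inj; rewrite /= mulrBr.
Qed.

Fact corner_pair_monoid : monoid_morphism corner_pair.
Proof.
split=> // x y; congr pair; apply/val_inj => /=.
  by case: (g) => e ee eC e0 /=; rewrite -[RHS]mulrA (mulrA x e) -eC !mulrA ee.
by case: (h) => e ee eC e0 /=; rewrite -[RHS]mulrA (mulrA x e) -eC !mulrA ee.
Qed.

HB.instance Definition _ := GRing.isZmodMorphism.Build R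
  (corner_ring g * corner_ring h)%type corner_pair corner_pair_zmod.
HB.instance Definition _ := GRing.isMonoidMorphism.Build R
  (corner_ring g * corner_ring h)%type corner_pair corner_pair_monoid.

Lemma corner_pair_bij : bijective corner_pair.
Proof.
exists (fun u => val u.1 + val u.2) => [x | [u v]] /=.
  by rewrite ghE mulrBl mul1r addrC subrK.
have gu := corner_valP u; have hv := corner_valP v.
have gv : cidem_val g * val v = 0.
  apply/eqP; have /eqP := hv.
  by rewrite ghE mulrBl mul1r subr_eq addrC -subr_eq subrr eq_sym.
congr pair; apply/val_inj; rewrite /= mulrDr ?gu ?gv ?addr0 //.
by rewrite hv ghE mulrBl mul1r gu subrr add0r.
Qed.

Definition corner_iso : {rmorphism R -> corner_ring g * corner_ring h} :=
  corner_pair.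

End Product.

Section Prime.
Variables (R : pzRingType) (Rreg : regular_ring R).
Hypotheses (Rcomp : complete_pideals R) (Rirr : irreducible_ring R).
Implicit Types a b c e f g x y z : R.

Lemma irreducible_cidem g : g * g = g -> (forall x, g * x = x * g) ->
  g = 0 \/ g = 1.
Proof.
move=> gg gC; case: (pselect (g = 0)) => [|g0]; first by left.
case: (pselect (1 - g = 0)) => [/subr0_eq/esym|h0]; first by right.
have hC x : (1 - g) * x = x * (1 - g) by rewrite mulrBl mulrBr mul1r mulr1 gC.
case: Rirr => _ []; exists (corner_ring (CIdem gg gC g0)).
exists (corner_ring (CIdem (idemC gg) hC h0)).
by exists (corner_iso _ _); apply: corner_pair_bij.
Qed.

Lemma semiprime x : (forall y, x * y * x = 0) -> x = 0.
Proof. by move=> h; have [y <-] := Rreg x; apply: h. Qed.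

(** The right annihilator [g R] of [a R] is a two-sided ideal, so [(1 - g) y g = 0] for all [y].
    Semiprimeness then kills [g R (1 - g)] as well, which makes [g] central, hence [0] or [1]. *)
Lemma prime_ring a b : (forall x, a * x * b = 0) -> a = 0 \/ b = 0.
Proof.
move=> ab.
have [g [gg gP]] := rann_principal Rreg Rcomp (fun s => exists x, s = a * x).
have gb : g * b = b by apply/gP => _ [x ->].
have ag x : a * x * g = 0 by apply: (gP g).1 gg _ _; exists x.
have lg x : g * (x * g) = x * g.
  by apply/gP => _ [y ->]; rewrite mulrA -(mulrA a) ag.
have gC x : g * x = x * g.
  rewrite -lg; apply/subr0_eq; apply: semiprime => y.
  have E : g * x - g * (x * g) = g * x * (1 - g) by nc.
  rewrite E.
  have -> : g * x * (1 - g) * y * (g * x * (1 - g)) =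
    g * x * (y * g - g * (y * g)) * (x * (1 - g)) by nc.
  by rewrite lg subrr mulr0 mul0r.
have [g0|g1] := irreducible_cidem gg gC; first by right; rewrite -gb g0 mul0r.
by left; rewrite -[a]mulr1 -[a * 1]mulr1 -{2}g1 ag.
Qed.

Lemma prime_exists a b : a <> 0 -> b <> 0 -> exists x, a * x * b <> 0.
Proof.
move=> a0 b0; apply: contrapT => h; suff /prime_ring[] : forall x, a * x * b = 0 by [].
by move=> x; apply: contrapT => abx; apply: h; exists x.
Qed.

End Prime.

(** * Maximal partial isomorphisms *)

Section Lattice.
Variables (R : pzRingType) (Rreg : regular_ring R).
Hypothesis Rcomp : complete_pideals R.
Hypothesis Rupper : forall (C : set (pideal R)) (I : pideal R),
  pideal_chain C -> pmeet I (psup C) = psup [set pmeet I J | J in C]%classic.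
Implicit Types (a b c d e f x y z : R) (I J K : pideal R) (C : set (pideal R)).

Lemma pideal_gen I : exists a, forall x, pideal_set I x <-> exists y, x = a * y.
Proof.
have : is_rideal (pideal_set I) by case: I.
by move=> /asboolP[a Ia]; exists a => x; rewrite Ia; exact: idealP.
Qed.

Lemma pidealM I x y : pideal_set I x -> pideal_set I (x * y).
Proof.
have [a Ia] := pideal_gen I.
by move=> /Ia[z ->]; apply/Ia; exists (z * y); rewrite mulrA.
Qed.

Lemma pidealB I x y : pideal_set I x -> pideal_set I y -> pideal_set I (x - y).
Proof.
have [a Ia] := pideal_gen I.
by move=> /Ia[z ->] /Ia[t ->]; apply/Ia; exists (z - t); rewrite mulrBr.
Qed.

Lemma pideal0 I : pideal_set I 0.
Proof. by have [a Ia] := pideal_gen I; apply/Ia; exists 0; rewrite mulr0. Qed.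

Lemma principalP a x : pideal_set (principal a) x <-> exists y, x = a * y.
Proof. exact: idealP. Qed.

Lemma le_pidealP I J :
  reflect (forall x, pideal_set I x -> pideal_set J x) (I <= J)%O.
Proof. exact: asboolP. Qed.

Lemma le_principal a I : pideal_set I a -> (principal a <= I)%O.
Proof. by move=> Ia; apply/le_pidealP => _ /principalP[y ->]; apply: pidealM. Qed.

Lemma psup_ub C J : C J -> (J <= psup C)%O.
Proof.
move=> CJ; have [supC _] := Rcomp C.
have [ub _] := xgetPex (principal 0) supC.
by rewrite /psup /supremum ifF; [exact: ub|apply/negbTE/set0P; exists J]. Qed.

Lemma psup_least C J : (forall K, C K -> K <= J)%O -> (psup C <= J)%O.
Proof.
move=> CJ; rewrite /psup /supremum; case: ifPn => [_|_].
  (* For the empty family the supremum is the default value [principal 0]. *)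
  by apply: le_principal; exact: pideal0.
have [supC _] := Rcomp C.
by have [_] := xgetPex (principal 0) supC; apply; exact: CJ.
Qed.

Lemma pmeetP I J x : pideal_set (pmeet I J) x <-> pideal_set I x /\ pideal_set J x.
Proof.
have [_ infC] := Rcomp [set I; J]%classic.
have [lb gl] := xgetPex (principal 1) infC.
have E : pmeet I J = xget (principal 1) (infimums [set I; J]%classic).
  rewrite /pmeet /pinf /infimum ifF //; apply/negbTE/set0P.
  by exists I; left.
rewrite E; split=> [h | [Ix Jx]].
  by split; [move: h; apply/le_pidealP/lb; left|move: h; apply/le_pidealP/lb; right].
suff /le_pidealP : (principal x <= xget (principal 1) (infimums [set I; J]%classic))%O.
  by apply; apply/principalP; exists 1; rewrite mulr1.
by apply: gl => K [->|->]; exact: le_principal.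
Qed.

Definition disj I J := forall x, pideal_set I x -> pideal_set J x -> x = 0.

Definition insum I J K := forall x, pideal_set I x ->
  exists a b, [/\ pideal_set J a, pideal_set K b & x = a + b].

Lemma disj_sym I J : disj I J -> disj J I.
Proof. by move=> h x ? ?; apply: h. Qed.

(** Upper continuity enters the proof here: the meet of [I] with the supremum is the supremum of the
    meets with the members, all zero. *)
Lemma disj_psup I C : pideal_chain C -> (forall J, C J -> disj I J) ->
  disj I (psup C).
Proof.
move=> chC IC x Ix Cx; have : pideal_set (pmeet I (psup C)) x by apply/pmeetP.
rewrite (Rupper _ chC).
have /le_pidealP h : (psup [set pmeet I J | J in C]%classic <= principal 0)%O.
  apply: psup_least => _ [J CJ <-]; apply/le_pidealP => y /pmeetP[Iy Jy].
  by rewrite (IC J CJ _ Iy Jy); exact: pideal0.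
by move=> /h /principalP[y ->]; rewrite mul0r.
Qed.

Lemma pideal_sum a b : exists I, forall x, pideal_set I x <->
  exists y z, x = a * y + b * z.
Proof.
have [p [q [y [[_ _ _ qp] [[pa [u pu]] qb qE]]]]] := ortho_sum Rreg a b.
exists (principal (p + q)) => x; rewrite principalP.
split=> [[z ->]|[c [d ->]]].
  by exists (u * (z - b * y * z)), (y * z); rewrite mulrA -pu qE; nc.
have qa : q * a = 0 by rewrite -pa mulrA qp mul0r.
by exists (a * c + b * d); rewrite mulrDr !mulrA qb mulrDl pa qa addr0.
Qed.

(** The sum of two principal right ideals is principal, so it is an upper bound of [C] in the
    lattice. *)
Lemma insum_psup I J C : (forall K, C K -> insum K I J) -> insum (psup C) I J.
Proof.
have [a Ia] := pideal_gen I; have [b Jb] := pideal_gen J.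
have [S Sab] := pideal_sum a b => h.
have /le_pidealP CS : (psup C <= S)%O.
  apply: psup_least => K CK; apply/le_pidealP => x /(h _ CK).
  by move=> [_ [_ [/Ia[y ->] /Jb[z ->] ->]]]; apply/Sab; exists y, z.
move=> _ /CS/Sab[y [z ->]]; exists (a * y), (b * z).
by split=> //; [apply/Ia; exists y|apply/Jb; exists z].
Qed.

(** A triple [(A, B, G)] encodes an isomorphism from [A] inside [e R] to [B] inside [f R] by its
    graph [G]: the three ideals are pairwise disjoint and each lies in the sum of the other two.
    Such lattice conditions pass to suprema of chains. *)
Record perspective e f (t : pideal R * pideal R * pideal R) : Prop := {
  persp_l : forall x, pideal_set t.1.1 x -> e * x = x;
  persp_r : forall x, pideal_set t.1.2 x -> f * x = x;
  persp_lr : disj t.1.1 t.1.2;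
  persp_lg : disj t.1.1 t.2;
  persp_rg : disj t.1.2 t.2;
  persp_sg : insum t.2 t.1.1 t.1.2;
  persp_sl : insum t.1.1 t.1.2 t.2;
  persp_sr : insum t.1.2 t.1.1 t.2 }.

(** A generator [u] of the graph splits as [a + b]; then [a] and [b] generate the two ideals and
    [a x -> b x] is the encoded isomorphism. *)
Lemma perspectiveP e f t : perspective e f t -> exists a b,
  [/\ e * a = a, f * b = b, same_rann a b & forall x y, a * x = b * y -> a * x = 0]
  /\ [/\ forall x, pideal_set t.1.1 x <-> exists y, x = a * y,
         forall x, pideal_set t.1.2 x <-> exists y, x = b * y
       & forall x, pideal_set t.2 x <-> exists y, x = (a + b) * y].
Proof.
case: t => [[A B] G] [/= lE rF lr lg rg sg sl sr].
have [u Gu] := pideal_gen G.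
have GuM y : pideal_set G (u * y) by apply/Gu; exists y.
have [a [b [Aa Bb uE]]] : exists a b, [/\ pideal_set A a, pideal_set B b & u = a + b].
  by apply: sg; rewrite -[u]mulr1.
have az z : a * z = 0 -> b * z = 0.
  move=> az0; have bz : u * z = b * z by rewrite uE mulrDl az0 add0r.
  by apply: rg; [exact: pidealM|rewrite -bz].
have bz z : b * z = 0 -> a * z = 0.
  move=> bz0; have bz : u * z = a * z by rewrite uE mulrDl bz0 addr0.
  by apply: lg; [exact: pidealM|rewrite -bz].
exists a, b; split.
  split; [exact: lE|exact: rF|by move=> z; split; [exact: az|exact: bz]|].
  by move=> x y xy; apply: lr; [|rewrite xy]; exact: pidealM.
split=> x; [| |by rewrite -uE].
- split=> [Ax|[y ->]]; last exact: pidealM.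
  have [y [_ [By /Gu[z ->] xE]]] := sl _ Ax; exists z.
  apply/subr0_eq/lr; first by apply: pidealB => //; exact: pidealM.
  have -> : x - a * z = y - b * (- z) by rewrite xE uE; nc.
  by apply: pidealB => //; exact: pidealM.
- split=> [Bx|[y ->]]; last exact: pidealM.
  have [y [_ [Ay /Gu[z ->] xE]]] := sr _ Bx; exists z.
  apply/subr0_eq/lr; last by apply: pidealB => //; exact: pidealM.
  have -> : x - b * z = y - a * (- z) by rewrite xE uE; nc.
  by apply: pidealB => //; exact: pidealM.
Qed.

Definition perspective_le e f (s t : {t | perspective e f t}) : bool :=
  [&& (sval s).1.1 <= (sval t).1.1, (sval s).1.2 <= (sval t).1.2
    & (sval s).2 <= (sval t).2]%O.

(** [disj_psup] is applied in each variable in turn; for two different indices the larger one serves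
    both ideals. *)
Lemma disj_psup2 T (D : set T) (F H : T -> pideal R) :
  total_on D (fun s t => (F s <= F t)%O && (H s <= H t)%O) ->
  (forall t, D t -> disj (F t) (H t)) ->
  disj (psup [set F t | t in D]%classic) (psup [set H t | t in D]%classic).
Proof.
move=> tot FH; apply: disj_psup => [_ _ [s Ds <-] [t Dt <-]|_ [t Dt <-]].
  by have [/andP[]|/andP[]] := tot _ _ Ds Dt; [left|right].
apply/disj_sym/disj_psup => [_ _ [s Ds <-] [u Du <-]|_ [s Ds <-]].
  by have [/andP[]|/andP[]] := tot _ _ Ds Du; [left|right].
move=> x Hx Fx; have [/andP[/le_pidealP Fst _]|/andP[_ /le_pidealP Hst]] := tot _ _ Ds Dt.
  by apply: (FH t) => //; exact: Fst.
by apply: (FH s) => //; exact: Hst.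
Qed.

Lemma perspective_sup e f (D : set {t | perspective e f t}) :
  total_on D (@perspective_le e f) ->
  perspective e f (psup [set (sval t).1.1 | t in D],
    psup [set (sval t).1.2 | t in D], psup [set (sval t).2 | t in D])%classic.
Proof.
move=> tot.
have idle c (C : set (pideal R)) :
    (forall I, C I -> forall x, pideal_set I x -> c * x = x) ->
    forall x, pideal_set (psup C) x -> c * x = x.
  (* The elements fixed by [c] form the right annihilator of [1 - c], a principal right ideal, so
     being fixed by [c] passes to suprema. *)
  move=> h; have [i [ii iP]] := rann_principal Rreg Rcomp (fun s => s = 1 - c).
  have iE x : i * x = x <-> c * x = x.
    rewrite iP; split=> [/(_ _ erefl)/eqP|cx _ ->].
      by rewrite mulrBl mul1r subr_eq0 => /eqP.
    by rewrite mulrBl mul1r cx subrr.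
  suff /le_pidealP k : (psup C <= principal i)%O.
    move=> x /k /principalP[y ->]; apply/iE.
    by rewrite mulrA ii.
  apply: psup_least => I CI; apply/le_pidealP => x Ix; apply/principalP.
  by exists x; apply/esym/iE/(h I).
have ub11 t : D t -> ((sval t).1.1 <= psup [set (sval t).1.1 | t in D]%classic)%O.
  by move=> Dt; apply: psup_ub; exists t.
have ub12 t : D t -> ((sval t).1.2 <= psup [set (sval t).1.2 | t in D]%classic)%O.
  by move=> Dt; apply: psup_ub; exists t.
have ub2 t : D t -> ((sval t).2 <= psup [set (sval t).2 | t in D]%classic)%O.
  by move=> Dt; apply: psup_ub; exists t.
split=> /=.
- by apply: idle => _ [t Dt <-] x; exact: (persp_l (svalP t)).
- by apply: idle => _ [t Dt <-] x; exact: (persp_r (svalP t)).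
- apply: disj_psup2 => [s t Ds Dt|t Dt]; last exact: (persp_lr (svalP t)).
  by have [/and3P[-> -> _]|/and3P[-> -> _]] := tot _ _ Ds Dt; [left|right].
- apply: disj_psup2 => [s t Ds Dt|t Dt]; last exact: (persp_lg (svalP t)).
  by have [/and3P[-> _ ->]|/and3P[-> _ ->]] := tot _ _ Ds Dt; [left|right].
- apply: disj_psup2 => [s t Ds Dt|t Dt]; last exact: (persp_rg (svalP t)).
  by have [/and3P[_ -> ->]|/and3P[_ -> ->]] := tot _ _ Ds Dt; [left|right].
- apply: insum_psup => _ [t Dt <-] x /(persp_sg (svalP t))[a [b [ta tb ->]]].
  exists a, b; split=> //;
    [move: ta; exact/le_pidealP/ub11|move: tb; exact/le_pidealP/ub12].
- apply: insum_psup => _ [t Dt <-] x /(persp_sl (svalP t))[a [b [ta tb ->]]].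
  exists a, b; split=> //;
    [move: ta; exact/le_pidealP/ub12|move: tb; exact/le_pidealP/ub2].
- apply: insum_psup => _ [t Dt <-] x /(persp_sr (svalP t))[a [b [ta tb ->]]].
  exists a, b; split=> //;
    [move: ta; exact/le_pidealP/ub11|move: tb; exact/le_pidealP/ub2].
Qed.

Lemma perspective0 e f :
  perspective e f (principal 0, principal 0, principal 0).
Proof.
have z x : pideal_set (principal 0) x -> x = 0.
  by move=> /principalP[y ->]; rewrite mul0r.
split=> /= x; try by move=> /z ->; rewrite mulr0.
- by move=> /z.
- by move=> /z.
- by move=> /z.
- by move=> /z ->; exists 0, 0; rewrite addr0; split=> //; exact: pideal0.
- by move=> /z ->; exists 0, 0; rewrite addr0; split=> //; exact: pideal0.
- by move=> /z ->; exists 0, 0; rewrite addr0; split=> //; exact: pideal0.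
Qed.

(** Zorn's lemma gives a maximal graph. A further pair [c], [d] independent of it could be adjoined,
    with [c + d] added to the graph, so it must vanish. Orthogonal [e], [f] yield comparability, and
    [e = f] yields halving. *)
Lemma maximal_equiv e f : exists a b,
  [/\ e * a = a, f * b = b, same_rann a b & forall x y, a * x = b * y -> a * x = 0]
  /\ forall c d, e * c = c -> f * d = d -> same_rann c d ->
    (forall x y z t, a * x + b * y + (c * z + d * t) = 0 ->
       [/\ a * x = 0, b * y = 0, c * z = 0 & d * t = 0]) -> c = 0.
Proof.
have [||D tot|t tmax] := @ZL_preorder _ (exist _ _ (perspective0 e f))
  (@perspective_le e f).
- by move=> t; rewrite /perspective_le !lexx.
- move=> r s t /and3P[r1 r2 r3] /and3P[s1 s2 s3].
  by apply/and3P; split; [exact: le_trans s1|exact: le_trans s2|exact: le_trans s3].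
- exists (exist _ _ (perspective_sup tot)) => s Ds.
  by apply/and3P; split; apply: psup_ub; exists s.
have [a [b [[ea fb ab abi] [tA tB tG]]]] := perspectiveP (svalP t).
exists a, b; split=> // c d ec fd cd ind.
have [A Ac] := pideal_sum a c; have [B Bd] := pideal_sum b d.
have [G Gd] := pideal_sum (a + b) (c + d).
have p : perspective e f (A, B, G).
  split=> /= x.
  - by move=> /Ac[y [z ->]]; rewrite mulrDr !mulrA ea ec.
  - by move=> /Bd[y [z ->]]; rewrite mulrDr !mulrA fb fd.
  - move=> /Ac[y [z ->]] /Bd[y' [z' E]].
    have H : a * y + b * - y' + (c * z + d * - z') = 0.
      by rewrite !mulrN addrACA E -opprD subrr.
    by have [-> _ -> _] := ind _ _ _ _ H; rewrite addr0.
  - move=> /Ac[y [z ->]] /Gd[y' [z' E]].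
    have H : a * (y - y') + b * - y' + (c * (z - z') + d * - z') = 0.
      by rewrite -[RHS](subrr (a * y + c * z)) {2}E; nc.
    have [ay bz cz dz] := ind _ _ _ _ H.
    have /ab ay' : b * y' = 0 by apply/oppr_inj; rewrite oppr0 -mulrN.
    have /cd cz' : d * z' = 0 by apply/oppr_inj; rewrite oppr0 -mulrN.
    move: ay cz; rewrite !mulrBr ay' cz' !subr0 => -> ->; by rewrite addr0.
  - move=> /Bd[y [z ->]] /Gd[y' [z' E]].
    have H : a * - y' + b * (y - y') + (c * - z' + d * (z - z')) = 0.
      by rewrite -[RHS](subrr (b * y + d * z)) {2}E; nc.
    have [ay bz cz dz] := ind _ _ _ _ H.
    have /ab ay' : a * y' = 0 by apply/oppr_inj; rewrite oppr0 -mulrN.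
    have /cd cz' : c * z' = 0 by apply/oppr_inj; rewrite oppr0 -mulrN.
    move: bz dz; rewrite !mulrBr ay' cz' !subr0 => -> ->; by rewrite addr0.
  - move=> /Gd[y [z ->]]; exists (a * y + c * z), (b * y + d * z).
    split; [by apply/Ac; exists y, z|by apply/Bd; exists y, z|nc].
  - move=> /Ac[y [z ->]]; exists (b * - y + d * - z), ((a + b) * y + (c + d) * z).
    split; [by apply/Bd; exists (- y), (- z)|by apply/Gd; exists y, z|nc].
  - move=> /Bd[y [z ->]]; exists (a * - y + c * - z), ((a + b) * y + (c + d) * z).
    split; [by apply/Ac; exists (- y), (- z)|by apply/Gd; exists y, z|nc].
have /tmax : perspective_le t (exist _ _ p).
  apply/and3P; split; apply/le_pidealP => x /=.
  - by move=> /tA[y ->]; apply/Ac; exists y, 0; rewrite mulr0 addr0.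
  - by move=> /tB[y ->]; apply/Bd; exists y, 0; rewrite mulr0 addr0.
  - by move=> /tG[y ->]; apply/Gd; exists y, 0; rewrite mulr0 addr0.
case/and3P => /le_pidealP /= /(_ c) h _ _.
have /tA[y cy] : pideal_set (sval t).1.1 c.
  by apply: h; apply/Ac; exists 0, 1; rewrite mulr0 mulr1 add0r.
have H : a * y + b * 0 + (c * - 1 + d * 0) = 0.
  by rewrite !mulr0 !addr0 mulrN mulr1 cy subrr.
by have [_ _] := ind _ _ _ _ H; rewrite mulrN mulr1 => /eqP; rewrite oppr_eq0 => /eqP.
Qed.

End Lattice.

(** * Comparability, cancellation and halving *)

Section Rank.
Variables (R : pzRingType) (K : realType) (rk : R -> K).
Hypotheses (Rirr : irreducible_ring R) (Rcont : continuous_ring R).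
Hypothesis rkP : rank_function rk.
Implicit Types a b c d e f p q w x y z : R.

Let Rreg : regular_ring R. Proof. by case: Rcont. Qed.
Let Rcomp : complete_pideals R. Proof. by case: Rcont. Qed.
Let Rupper (C : set (pideal R)) (I : pideal R) : pideal_chain C ->
  pmeet I (psup C) = psup [set pmeet I J | J in C]%classic.
Proof. by case: Rcont => _ _ h _; exact: h. Qed.
Let Rprime := prime_exists Rreg Rcomp Rirr.

Lemma rk0 : rk 0 = 0.
Proof.
have := rankD rkP (mulr0 0) (mulr0 0) (conj (mulr0 0) (mulr0 0)).
by rewrite addr0 => h; lra.
Qed.

Lemma rkMl a b : rk (a * b) <= rk a.
Proof. by apply: le_trans (rankM rkP a b) _; rewrite ge_min lexx. Qed.

Lemma rkMr a b : rk (a * b) <= rk b.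
Proof. by apply: le_trans (rankM rkP a b) _; rewrite ge_min lexx orbT. Qed.

Lemma rk_le0 a : rk a <= 0 -> a = 0.
Proof.
move=> ra; apply: contrapT => /(rank_gt0 rkP); by rewrite ltNge ra.
Qed.

Lemma subidem_rk p e : e * e = e -> subidem p e -> rk e = rk p + rk (e - p).
Proof.
move=> ee pe; have [qq _ _] := subidemC ee pe; have [pp ep pe'] := pe.
rewrite -(rankD rkP) //; first by congr rk; nc.
by split; rewrite ?mulrBr ?mulrBl ?(pp, pe', ep) !subrr.
Qed.

Lemma rkC e : e * e = e -> rk (1 - e) = 1 - rk e.
Proof.
move=> ee; rewrite -(rank1 rkP).
have := @subidem_rk e 1; rewrite !mul1r => -> //; first by rewrite addrAC subrr add0r.
by split; rewrite ?mulr1 ?mul1r.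
Qed.

Lemma rk_subidem_le p e : subidem p e -> rk p <= rk e.
Proof. by move=> [_ <- _]; exact: rkMl. Qed.

Lemma subidem_eq p e : e * e = e -> subidem p e -> rk e <= rk p -> p = e.
Proof.
move=> ee pe; rewrite (subidem_rk ee pe) => h; apply/esym/subr0_eq/rk_le0; lra.
Qed.

Lemma generates_rk p a : generates p a -> rk p = rk a.
Proof.
move=> [pa [z pz]]; apply: le_anti; rewrite {1}pz rkMl /=.
by rewrite -{1}pa rkMl.
Qed.

Lemma idem_equiv_rk e f : idem_equiv e f -> rk e = rk f.
Proof.
have le e' f' : idem_equiv e' f' -> rk e' <= rk f'.
  move=> [w [w' [[fw _ _ _] [<- _]]]]; rewrite -fw.
  by apply: le_trans (rkMr _ _) (rkMl _ _).
by move=> ef; apply: le_anti; rewrite !le //; exact: idem_equiv_sym.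
Qed.

Lemma rk_sum a b : exists s, [/\ s * s = s, s * a = a, s * b = b &
  rk s <= rk a + rk b].
Proof.
have [p [q [y [[pp qq pq qp] [gp sb qE]]]]] := ortho_sum Rreg a b.
have pa : p * a = a by case: gp.
exists (p + q); split=> //.
- by rewrite !mul_expand ?(pp, qq, pq, qp); nc.
- by rewrite mulrDl -{2}pa mulrA qp mul0r addr0.
rewrite (rankD rkP) // (generates_rk gp) lerD2l qE.
by apply: le_trans (rkMl _ _) (rkMr _ _).
Qed.

(** [e x -> d x] embeds [e R] into [f R], and any idempotent generating the image [d R] is
    equivalent to [e]. *)
Lemma embed_equiv e f d : e * e = e -> f * f = f -> f * d = d ->
  same_rann d e -> exists q, subidem q f /\ idem_equiv e q.
Proof.
move=> ee ff fd de; have [q [qf gq]] := generatesP Rreg ff fd.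
exists q; split=> //; have [qq _ _] := qf.
apply: (idem_equiv_rann Rreg _ ee qq _ gq); first exact: same_rann_sym.
by split=> //; exists e.
Qed.

(** [b * u * e] is the image of [e = a * u] under the isomorphism [a x -> b x]. *)
Lemma same_rann_image e a b u : e * e = e -> e = a * u -> same_rann a b ->
  same_rann (b * u * e) e.
Proof.
move=> ee eE ab z; rewrite -!mulrA; split=> [/ab|ez]; last by rewrite ez !mulr0.
by rewrite !mulrA -eE ee.
Qed.

(* A nonzero [y = q x p] is an isomorphism from a nonzero part of [pR] onto
   [yR]. *)
Lemma partial_equiv p q : p * p = p -> q * q = q -> p <> 0 -> q <> 0 ->
  exists c d, [/\ p * c = c, q * d = d, same_rann c d & c <> 0].
Proof.
move=> pp qq p0 q0; have [x y0] := Rprime q0 p0.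
have [y yE] : exists y, y = q * x * p by exists (q * x * p).
rewrite -yE in y0.
have [y' yy] := Rreg y.
have yp : y * p = y by rewrite yE -mulrA pp.
exists (p * y' * y), y; split.
- by rewrite !mulrA pp.
- by rewrite yE !mulrA qq.
- move=> z; split=> h; last by rewrite -mulrA h mulr0.
  by have := congr1 ( *%R y) h; rewrite mulr0 !mulrA yp yy.
- by move=> h; apply: y0; have := congr1 ( *%R y) h; rewrite mulr0 !mulrA yp yy.
Qed.

(** If a maximal partial isomorphism leaves a remainder on both sides, primeness provides an
    isomorphism between nonzero parts of the remainders, against maximality. *)
Lemma orth_compare e f : e * e = e -> f * f = f -> e * f = 0 -> f * e = 0 ->
  (exists q, subidem q f /\ idem_equiv e q) \/ (exists p, subidem p e /\ idem_equiv f p).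
Proof.
move=> ee ff ef fe.
have [a [b [[ea fb ab abi] maxab]]] := maximal_equiv Rreg Rcomp Rupper e f.
have [p [pe [pa [u pu]]]] := generatesP Rreg ee ea.
have [q [qf [qb [v qv]]]] := generatesP Rreg ff fb.
have [pE|pE] := pselect (e - p = 0).
  left; apply: (@embed_equiv _ _ (b * u * e)) => //; first by rewrite !mulrA fb.
  by apply: same_rann_image ab; rewrite // -pu; exact: subr0_eq.
have [qE|qE] := pselect (f - q = 0).
  right; apply: (@embed_equiv _ _ (a * v * f)) => //; first by rewrite !mulrA ea.
  apply: same_rann_image (same_rann_sym ab) => //; rewrite -qv; exact: subr0_eq.
have [pp' ep' pe'] := subidemC ee pe; have [qq' fq' qf'] := subidemC ff qf.
have [c [d [pc qd cd c0]]] := partial_equiv pp' qq' pE qE.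
have ec : e * c = c by rewrite -pc mulrA ep'.
have fd : f * d = d by rewrite -qd mulrA fq'.
have [pp ep pe0] := pe; have [qq fq qf0] := qf.
have pc0 : p * c = 0 by rewrite -pc mulrA mulrBr pe0 pp subrr mul0r.
have qd0 : q * d = 0 by rewrite -qd mulrA mulrBr qf0 qq subrr mul0r.
have eb : e * b = 0 by rewrite -fb mulrA ef mul0r.
have ed : e * d = 0 by rewrite -fd mulrA ef mul0r.
have fa : f * a = 0 by rewrite -ea mulrA fe mul0r.
have fc : f * c = 0 by rewrite -ec mulrA fe mul0r.
case: c0; apply: (maxab c d) => // x y z t E.
have E1 : a * x + c * z = 0.
  move: (congr1 ( *%R e) E); rewrite mulr0 !mulrDr !mulrA ea ec eb ed !mul0r.
  by rewrite !addr0.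
have E2 : b * y + d * t = 0.
  move: (congr1 ( *%R f) E); rewrite mulr0 !mulrDr !mulrA fb fd fa fc !mul0r.
  by rewrite !add0r.
have E3 : a * x = 0.
  by move: (congr1 ( *%R p) E1); rewrite mulr0 mulrDr !mulrA pa pc0 mul0r addr0.
have E4 : b * y = 0.
  by move: (congr1 ( *%R q) E2); rewrite mulr0 mulrDr !mulrA qb qd0 mul0r addr0.
by split=> //; [move: E1; rewrite E3 add0r|move: E2; rewrite E4 add0r].
Qed.

Lemma orth_rk_compare e f : e * e = e -> f * f = f -> e * f = 0 -> f * e = 0 ->
  rk e <= rk f -> exists q, subidem q f /\ idem_equiv e q.
Proof.
move=> ee ff ef fe le_ef.
have [//|[p [pe fp]]] := orth_compare ee ff ef fe.
have pE : p = e by apply: subidem_eq; rewrite // -(idem_equiv_rk fp).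
by exists f; split; [split|apply: idem_equiv_sym; rewrite -pE].
Qed.

(** The common part [i R] of [e R] and [f R] is split off. The remainders [e1 R] and [f1 R] are
    independent, so they have orthogonal generators, to which the orthogonal case applies. *)
Lemma rk_compare e f : e * e = e -> f * f = f -> rk e <= rk f ->
  exists q, subidem q f /\ idem_equiv e q.
Proof.
move=> ee ff le_ef.
have [i [ii iP]] := meet_idem Rreg Rcomp e f.
have [ei fi] := (iP i).1 ii.
have [i1 [[i1i1 ei1 i1e] gi1]] := generatesP Rreg ee ei.
have [i2 [[i2i2 fi2 i2f] gi2]] := generatesP Rreg ff fi.
have ri1 := generates_rk gi1; have ri2 := generates_rk gi2.
have [ee1 e1e e1e'] := subidemC ee (And3 i1i1 ei1 i1e).
have [ff1 f1f f1f'] := subidemC ff (And3 i2i2 fi2 i2f).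
have re1 := subidem_rk ee (And3 i1i1 ei1 i1e).
have rf1 := subidem_rk ff (And3 i2i2 fi2 i2f).
have [e1 e1E] : exists e1, e1 = e - i1 by exists (e - i1).
have [f1 f1E] : exists f1, f1 = f - i2 by exists (f - i2).
rewrite -e1E -f1E in re1 rf1 ee1 e1e e1e' ff1 f1f f1f'.
have i1e1 : i1 * e1 = 0 by rewrite e1E mulrBr i1e i1i1 subrr.
have i2f1 : i2 * f1 = 0 by rewrite f1E mulrBr i2f i2i2 subrr.
have i1z z : i * z = z -> i1 * z = z by case: gi1 => h _ <-; rewrite mulrA h.
have i2z z : i * z = z -> i2 * z = z by case: gi2 => h _ <-; rewrite mulrA h.
have ind x y : e1 * x = f1 * y -> e1 * x = 0.
  move=> xy; have <- : i1 * (e1 * x) = e1 * x; last by rewrite mulrA i1e1 mul0r.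
  by apply/i1z/iP; split; [rewrite mulrA e1e|rewrite xy mulrA f1f].
have [e2 [f2 [[e2e2 f2f2 ef2 fe2] [ge2 gf2]]]] := ortho_gen Rreg ind.
have re2 := generates_rk ge2; have rf2 := generates_rk gf2.
have [|q [[qq f2q qf2] eq]] := orth_rk_compare e2e2 f2f2 ef2 fe2.
  rewrite re2 rf2; move: re1 rf1 le_ef; rewrite ri1 ri2; lra.
have [x [x' [[qx xe xx1 xx2] [xx xx']]]] := eq.
have [e2e1 _] := ge2; have [_ [t f2t]] := gf2.
have f1x : f1 * x = x by rewrite -qx -f2q f2t !mulrA ff1.
have i1i : i * i1 = i1 by case: gi1 => _ [s ->]; rewrite mulrA ii.
have i2i1 : i2 * i1 = i1 by apply: i2z.
(* The embedding is the identity on the common part and [x] on the remainder. *)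
apply: (@embed_equiv _ _ (i1 + x * e1)) => // [|z].
  rewrite mulrDr mulrA; congr (_ + _); first by rewrite -i2i1 mulrA fi2.
  by rewrite -f1x mulrA f1f.
split=> [|ez]; last first.
  by rewrite mulrDl -mulrA -e1e' -i1e -!mulrA ez !mulr0 addr0.
rewrite mulrDl => h.
have h1 : i1 * z = 0.
  have := congr1 ( *%R i2) h; rewrite mulr0 mulrDr !mulrA i2i1.
  by rewrite -f1x -!mulrA (mulrA i2) i2f1 mul0r addr0.
have h2 : e1 * z = 0.
  move: h; rewrite h1 add0r => /(congr1 ( *%R x')).
  by rewrite mulr0 !mulrA xx e2e1.
by move: h2; rewrite e1E mulrBl h1 subr0.
Qed.

Lemma rk_equiv e f : e * e = e -> f * f = f -> rk e = rk f -> idem_equiv e f.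
Proof.
move=> ee ff ref; have le_ef : rk e <= rk f by rewrite ref.
have [q [qf eq]] := rk_compare ee ff le_ef.
by rewrite -(subidem_eq ff qf) // -ref (idem_equiv_rk eq).
Qed.

Hypothesis Rnd : ~ rank_discrete rk.

(** Otherwise every ball of radius [r] is a singleton and the topology is discrete. *)
Lemma rk_small (r : K) : 0 < r -> exists2 a, a <> 0 & rk a < r.
Proof.
move=> r0; apply: contrapT => h; apply: Rnd => A a Aa; exists r => // b /= dab.
have -> : b = a; last exact: Aa.
apply/esym/subr0_eq; apply: contrapT => ab; apply: h; by exists (a - b).
Qed.

(** A maximal partial isomorphism inside [e R] gives orthogonal equivalent [p] and [q] below [e]. A
    nonzero remainder would contain two disjoint isomorphic nonzero parts, against maximality. *)
Lemma halving e : e * e = e -> exists p, subidem p e /\ idem_equiv p (e - p).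
Proof.
move=> ee.
have [a [b [[ea eb ab abi] maxab]]] := maximal_equiv Rreg Rcomp Rupper e e.
have [p0 [q0 [[pp0 qq0 pq0 qp0] [gp0 gq0]]]] := ortho_gen Rreg abi.
have ep0 : e * p0 = p0 by case: gp0 => _ [z ->]; rewrite mulrA ea.
have eq0 : e * q0 = q0 by case: gq0 => _ [z ->]; rewrite mulrA eb.
(* Right multiplication by [e] keeps the right ideals and puts both idempotents below [e]. *)
pose p := p0 * e; pose q := q0 * e.
have pp : p * p = p by rewrite /p mulrA -(mulrA p0) ep0 pp0.
have qq : q * q = q by rewrite /q mulrA -(mulrA q0) eq0 qq0.
have pq : p * q = 0 by rewrite /p /q mulrA -(mulrA p0) eq0 pq0 mul0r.
have qp : q * p = 0 by rewrite /p /q mulrA -(mulrA q0) ep0 qp0 mul0r.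
have ep : e * p = p by rewrite /p mulrA ep0.
have pe : p * e = p by rewrite /p -mulrA ee.
have eq : e * q = q by rewrite /q mulrA eq0.
have qe : q * e = q by rewrite /q -mulrA ee.
have gp : generates p a.
  case: gp0 => pa [z pz]; split; first by rewrite /p -mulrA ea.
  by exists (z * e); rewrite mulrA -pz.
have gq : generates q b.
  case: gq0 => qb [z qz]; split; first by rewrite /q -mulrA eb.
  by exists (z * e); rewrite mulrA -qz.
have epq := idem_equiv_rann Rreg ab pp qq gp gq.
clearbody p q.
suff E : e - p - q = 0.
  by exists p; split=> //; rewrite (subr0_eq E).
apply: contrapT => c0; pose c := e - p - q.
have cc : c * c = c.
  by rewrite /c !mul_expand ?(ee, ep, pe, eq, qe, pp, qq, pq, qp); nc.
have ec : e * c = c by rewrite /c !mulrBr ee ep eq.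
have pc : p * c = 0 by rewrite /c !mulrBr pe pp pq; nc.
have qc : q * c = 0 by rewrite /c !mulrBr qe qp qq; nc.
rewrite -/c in c0; clearbody c.
(* An element of rank below [rk c] yields a nonzero idempotent [d1] properly below [c], so [c]
   splits into two nonzero orthogonal parts. *)
have [a0 a0n ra0] := rk_small (rank_gt0 rkP c0).
have [x y0] := Rprime c0 a0n.
have cy : c * (c * x * a0) = c * x * a0 by rewrite !mulrA cc.
have [d1 [d1c gd1]] := generatesP Rreg cc cy.
have d2c := subidemC cc d1c.
have [d1d1 cd1 d1c'] := d1c; have [d2d2 cd2 _] := d2c.
have d1n : d1 <> 0 by move=> d10; case: gd1; rewrite d10 mul0r => /esym.
have d2n : c - d1 <> 0.
  move=> /subr0_eq E; have := generates_rk gd1; rewrite -E => rc.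
  have := rkMr (c * x) a0; rewrite -rc; lra.
have [s [t [d1s d2t st s0]]] := partial_equiv d1d1 d2d2 d1n d2n.
have cs : c * s = s by rewrite -d1s mulrA cd1.
have ct : c * t = t by rewrite -d2t mulrA cd2.
have ps : p * s = 0 by rewrite -cs mulrA pc mul0r.
have pt : p * t = 0 by rewrite -ct mulrA pc mul0r.
have qs : q * s = 0 by rewrite -cs mulrA qc mul0r.
have qt : q * t = 0 by rewrite -ct mulrA qc mul0r.
have [pa _] := gp; have [qb _] := gq.
have pb : p * b = 0 by rewrite -qb mulrA pq mul0r.
have qa : q * a = 0 by rewrite -pa mulrA qp mul0r.
have d1t : d1 * t = 0 by rewrite -d2t mulrA mulrBr d1c' d1d1 subrr mul0r.
case: s0; apply: (maxab s t) => //.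
- by rewrite -cs mulrA ec.
- by rewrite -ct mulrA ec.
move=> k l m n E.
have E1 : a * k = 0.
  move: (congr1 ( *%R p) E).
  by rewrite mulr0 !mulrDr !mulrA pa ps pb pt !mul0r !addr0.
have E2 : b * l = 0.
  move: (congr1 ( *%R q) E).
  by rewrite mulr0 !mulrDr !mulrA qb qs qa qt !mul0r !addr0 add0r.
move: E; rewrite E1 E2 !add0r => E.
have E3 : s * m = 0.
  move: (congr1 ( *%R d1) E).
  by rewrite mulr0 !mulrDr !mulrA d1s d1t !mul0r !addr0.
by split=> //; move: E; rewrite E3 add0r.
Qed.

End Rank.

(** * Elementary operations *)

Section Corners.
Variable R : pzRingType.
Implicit Types a b c d e f p q w x y z : R.

Definition in_corner e x := e * x = x /\ x * e = x.

Definition corner_unit e a b :=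
  [/\ in_corner e a, in_corner e b, a * b = e & b * a = e].

(** The count [k] is recorded because infinitely many such products will be summed factor by factor.
    The factors are elements of the whole ring that act as [1] off the corner, so they stay valid in
    larger corners. *)
Fixpoint unipotent_prod e k x : Prop :=
  if k is k'.+1 then exists n y, [/\ in_corner e n, n * n = 0,
    unipotent_prod e k' y & x = (1 + n) * y] else x = 1.

Lemma in_corner_sub e f x : subidem e f -> in_corner e x -> in_corner f x.
Proof.
by move=> [_ fe ef] [ex xe]; split; [rewrite -ex mulrA fe|rewrite -xe -mulrA ef].
Qed.

Lemma in_cornerD e x y : in_corner e x -> in_corner e y -> in_corner e (x + y).
Proof. by move=> [ex xe] [ey ye]; rewrite /in_corner mulrDr ex ey mulrDl xe ye. Qed.

Lemma in_cornerM e x y : in_corner e x -> in_corner e y -> in_corner e (x * y).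
Proof. by move=> [ex _] [_ ye]; rewrite /in_corner mulrA ex -mulrA ye. Qed.

Lemma unipotent_prod_sub e f k x : subidem e f -> unipotent_prod e k x ->
  unipotent_prod f k x.
Proof.
move=> ef; elim: k x => //= k IH x [n [y [en nn yk ->]]].
by exists n, y; split=> //; [exact: in_corner_sub en|exact: IH].
Qed.

Lemma unipotent_prodM e k l x y : unipotent_prod e k x -> unipotent_prod e l y ->
  unipotent_prod e (k + l) (x * y).
Proof.
move=> + yl; elim: k x => /= [x ->|k IH x [n [z [en nn zk ->]]]]; first by rewrite mul1r.
by exists n, (z * y); split=> //; [exact: IH|rewrite mulrA].
Qed.

Lemma unipotent_prod1 e n : in_corner e n -> n * n = 0 ->
  unipotent_prod e 1 (1 + n).
Proof. by move=> en nn; exists n, 1; rewrite mulr1. Qed.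

Lemma unipotent_prod_id e k x y : unipotent_prod e k x -> e * y = 0 -> x * y = y.
Proof.
move=> xk ey; elim: k x xk => /= [x ->|k IH x [n [z [[_ ne] nn zk ->]]]].
  by rewrite mul1r.
by rewrite -mulrA (IH _ zk) mulrDl mul1r -ne -mulrA ey mulr0 addr0.
Qed.

Lemma unipotent_prod_comm e k x : e * e = e -> unipotent_prod e k x ->
  e * x = x * e.
Proof.
move=> ee; elim: k x => /= [x ->|k IH x [n [y [[en ne] nn /IH ey ->]]]].
  by rewrite mul1r mulr1.
by rewrite mulrA mulrDr mulr1 en -mulrA -ey mulrA [(1 + n) * e]mulrDl mul1r ne.
Qed.

(** In block form over [e] and [f] the product is the Weyl matrix with off-diagonal entries [u] and
    [- u'] and zero diagonal; off [e + f] it is [1]. *)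
Lemma weyl_prod e f u u' : u * u' = e -> u' * u = f -> e * u = u -> u * f = u ->
  f * u' = u' -> u' * e = u' -> e * f = 0 -> f * e = 0 ->
  (1 + u) * (1 - u') * (1 + u) = 1 - e - f + u - u'.
Proof.
move=> uu' u'u eu uf fu' u'e ef fe.
have uu : u * u = 0 by rewrite -{2}eu -uf -mulrA (mulrA f) fe mul0r mulr0.
by rewrite !mul_expand uu' u'u uu eu; nc.
Qed.

(* [diag(a, a^-1)] is a product of two Weyl elements, each a product of three
   elementary matrices. *)
Lemma whitehead e f w w' a a' : e * e = e -> f * f = f -> e * f = 0 -> f * e = 0 ->
  f * w = w -> w * e = w -> e * w' = w' -> w' * f = w' -> w' * w = e ->
  w * w' = f -> corner_unit e a a' ->
  unipotent_prod (e + f) 6 (a + w * a' * w' + (1 - e - f)).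
Proof.
move=> ee ff ef fe fw we ew' w'f w'w ww' [[ea ae] [ea' a'e] aa' a'a].
have [u uE] : exists u, u = a * w' by exists (a * w').
have [u' u'E] : exists u', u' = w * a' by exists (w * a').
have eu : e * u = u by rewrite uE mulrA ea.
have uf : u * f = u by rewrite uE -mulrA w'f.
have fu' : f * u' = u' by rewrite u'E mulrA fw.
have u'e : u' * e = u' by rewrite u'E -mulrA a'e.
have uu' : u * u' = e by rewrite uE u'E mulrA -(mulrA a) w'w ae aa'.
have u'u : u' * u = f by rewrite uE u'E mulrA -(mulrA w) a'a we ww'.
have off x y : e * x = x -> x * f = x -> f * y = y -> y * e = y ->
    [/\ in_corner (e + f) x, in_corner (e + f) y, x * x = 0 & y * y = 0].
  move=> ex xf fy ye.
  have fx : f * x = 0 by rewrite -ex mulrA fe mul0r.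
  have xe : x * e = 0 by rewrite -xf -mulrA fe mulr0.
  have ey : e * y = 0 by rewrite -fy mulrA ef mul0r.
  have yf : y * f = 0 by rewrite -ye -mulrA ef mulr0.
  split; first (by split; rewrite ?mulrDr ?mulrDl ?(ex, xf, fx, xe) ?addr0 ?add0r).
  - by split; rewrite ?mulrDr ?mulrDl ?(fy, ye, ey, yf) ?addr0 ?add0r.
  - by rewrite -{1}xf -mulrA fx mulr0.
  - by rewrite -{1}ye -mulrA ey mulr0.
have neg x : in_corner (e + f) x -> x * x = 0 ->
    unipotent_prod (e + f) 1 (1 + x) /\ unipotent_prod (e + f) 1 (1 - x).
  move=> [cx xc] xx; split; apply: unipotent_prod1 => //.
    by split; rewrite ?mulrN ?mulNr ?cx ?xc.
  by rewrite mulrN mulNr opprK.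
have [uc u'c uu0 u'u'0] := off _ _ eu uf fu' u'e.
have [wc' wc ww'0 ww0] := off _ _ ew' w'f fw we.
have [u1 _] := neg _ uc uu0; have [_ u2] := neg _ u'c u'u'0.
have [_ w1] := neg _ wc' ww'0; have [w2 _] := neg _ wc ww0.
have -> : a + w * a' * w' + (1 - e - f) =
   (1 + u) * (1 - u') * (1 + u) * ((1 - w') * (1 + w) * (1 - w')).
  have -> := weyl_prod uu' u'u eu uf fu' u'e ef fe.
  have h : (1 - w') * (1 + w) * (1 - w') = 1 - e - f - w' + w.
    have := @weyl_prod e f (- w') (- w); rewrite !mulrN !mulNr !opprK.
    by move=> -> //; rewrite ?fw ?we ?ew' ?w'f.
  have ew : e * w = 0 by rewrite -fw mulrA ef mul0r.
  have fw' : f * w' = 0 by rewrite -ew' mulrA fe mul0r.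
  have ue : u * e = 0 by rewrite -uf -mulrA fe mulr0.
  have u'f : u' * f = 0 by rewrite -u'e -mulrA ef mulr0.
  have uw' : u * w' = 0 by rewrite -ew' mulrA ue mul0r.
  have u'w : u' * w = 0 by rewrite -fw mulrA u'f mul0r.
  have uw : u * w = a by rewrite uE -mulrA w'w ae.
  rewrite h -u'E !mul_expand ?(ee, ff, ef, fe, fw, ew', ew, fw', ue, uf, u'f, u'e,
    uw', u'w, uw).
  by nc.
rewrite -[6%N]/(1 + 1 + 1 + (1 + 1 + 1))%N.
by do !apply: unipotent_prodM.
Qed.

(** The row-by-column rule for the blocks cut out by [e] and [f]; [x] selects the row and [y] the
    column. *)
Lemma block_mul e f g h x y : e * e = e -> f * f = f -> g * (e + f) = g ->
  x * g * e * (e * h * y) + x * g * f * (f * h * y) = x * (g * h) * y.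
Proof.
move=> ee ff gE; rewrite -{3}gE !mulrA -(mulrA _ e e) ee -(mulrA _ f f) ff.
by rewrite !mul_expand; nc.
Qed.

(** With [a] invertible among the blocks [a], [b], [c], [d0] of [g], block elimination leaves
    [d0 - c a' b], whose inverse is the lower right block of [g']. *)
Lemma schur_complement e f g g' a' : e * e = e -> f * f = f -> e * f = 0 ->
  f * e = 0 -> corner_unit (e + f) g g' -> corner_unit e (e * g * e) a' ->
  exists d d' u, [/\ corner_unit f d d', unipotent_prod (e + f) 2 u &
    g + (1 - e - f) = u * (e * g * e + d + (1 - e - f))].
Proof.
move=> ee ff ef fe [[Eg gE] [Eg' g'E] gg' g'g] [[_ _] [ea' a'e] aa' a'a].
have bl x y := block_mul g' x y ee ff gE.
have bl' x y := block_mul g x y ee ff g'E.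
have [a aE] : exists a, a = e * g * e by exists (e * g * e).
have [b bE] : exists b, b = e * g * f by exists (e * g * f).
have [c cE] : exists c, c = f * g * e by exists (f * g * e).
have [d0 d0E] : exists d, d = f * g * f by exists (f * g * f).
have [d' d'E] : exists d, d = f * g' * f by exists (f * g' * f).
have [b' b'E] : exists d, d = e * g' * f by exists (e * g' * f).
have [c' c'E] : exists d, d = f * g' * e by exists (f * g' * e).
have gabcd : g = a + b + c + d0.
  by rewrite aE bE cE d0E -{1}Eg -{1}gE; nc.
have r1 : a * b' + b * d' = 0.
  by rewrite aE b'E bE d'E bl gg' mulrDr mulrDl ee ef mul0r addr0.
have r2 : c * b' + d0 * d' = f.
  by rewrite cE b'E d0E d'E bl gg' mulrDr fe ff add0r ff.
have r3 : c' * a + d' * c = 0.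
  by rewrite c'E d'E aE cE bl' g'g mulrDr fe ff add0r fe.
have r4 : c' * b + d' * d0 = f.
  by rewrite c'E bE d'E d0E bl' g'g mulrDr fe ff add0r ff.
have ea : e * a = a by rewrite aE !mulrA ee.
have ae : a * e = a by rewrite aE -mulrA ee.
have eb : e * b = b by rewrite bE !mulrA ee.
have bf : b * f = b by rewrite bE -mulrA ff.
have fc : f * c = c by rewrite cE !mulrA ff.
have ce : c * e = c by rewrite cE -mulrA ee.
have fd0 : f * d0 = d0 by rewrite d0E !mulrA ff.
have d0f : d0 * f = d0 by rewrite d0E -mulrA ff.
have fd' : f * d' = d' by rewrite d'E !mulrA ff.
have d'f : d' * f = d' by rewrite d'E -mulrA ff.
have eb' : e * b' = b' by rewrite b'E !mulrA ee.
have c'e : c' * e = c' by rewrite c'E -mulrA ee.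
rewrite -aE in aa' a'a *.
have {}r1 : b' = - (a' * b * d').
  apply/subr0_eq; rewrite opprK -mulrA -{1}eb' -a'a -mulrA -mulrDr r1.
  by rewrite mulr0.
have {}r3 : c' = - (d' * c * a').
  apply/subr0_eq; rewrite opprK -{1}c'e -aa' mulrA -mulrDl r3.
  by rewrite mul0r.
have ec : e * c = 0 by rewrite -fc mulrA ef mul0r.
have fb : f * b = 0 by rewrite -eb mulrA fe mul0r.
have fa' : f * a' = 0 by rewrite -ea' mulrA fe mul0r.
have a'f : a' * f = 0 by rewrite -a'e -mulrA ef mulr0.
have ed' : e * d' = 0 by rewrite -fd' mulrA ef mul0r.
have d'e : d' * e = 0 by rewrite -d'f -mulrA fe mulr0.
have d'b : d' * b = 0 by rewrite -eb mulrA d'e mul0r.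
have a'c : a' * c = 0 by rewrite -fc mulrA a'f mul0r.
have a'd0 : a' * d0 = 0 by rewrite -fd0 mulrA a'f mul0r.
have d'a : d' * a = 0 by rewrite -ea mulrA d'e mul0r.
have d'd0 : d' * d0 = f + d' * c * a' * b by rewrite -r4 r3; nc.
(* The usual right factor [1 + a' b] is moved to the left of the diagonal matrix, where it becomes
   [1 + b d']. *)
exists (d0 - c * a' * b), d', ((1 + c * a') * (1 + b * d')); split.
- split.
  + by split; rewrite ?mulrBr ?mulrBl ?mulrA ?fd0 ?fc -?mulrA ?d0f ?bf.
  + by [].
  + by rewrite -r2 r1; nc.
  + by rewrite -r4 r3; nc.
- rewrite -[2%N]/(1 + 1)%N; apply: unipotent_prodM; apply: unipotent_prod1.
  + by split; rewrite ?mulrDr ?mulrDl ?mulrA ?fc ?ec -?mulrA ?a'e ?a'f; nc.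
  + by rewrite mulrA -(mulrA c) a'c mulr0 mul0r.
  + by split; rewrite ?mulrDr ?mulrDl ?mulrA ?eb ?fb -?mulrA ?d'e ?d'f; nc.
  + by rewrite mulrA -(mulrA b) d'b mulr0 mul0r.
- pose rel := (d'a, mulr_under d'a, d'd0, mulr_under d'd0, mulr_under d'e,
    mulr_under d'f, mulr_under d'b, mulr_under a'c, mulr_under a'd0, bf, mulr_under bf,
    mulr_under a'a, ce, mulr_under ce, mulr_under a'e, mulr_under a'f).
  by rewrite gabcd !mul_expand ?rel !mul_expand ?rel; nc.
Qed.

End Corners.

(** * Unit-regularity and reduction of units to a smaller corner *)

Section Generation.
Variables (R : pzRingType) (K : realType) (rk : R -> K).
Hypotheses (Rirr : irreducible_ring R) (Rcont : continuous_ring R).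
Hypothesis rkP : rank_function rk.
Implicit Types a b c d e f p q w x y z : R.

Let Rreg : regular_ring R. Proof. by case: Rcont. Qed.

(** [a] maps [p R] isomorphically onto [q R]. The complements [e - p] and [e - q] then have equal
    rank, so an isomorphism [x] between them completes [a] to a unit [a + x]. *)
Lemma corner_unit_regular e a : e * e = e -> in_corner e a ->
  exists v v' p, [/\ corner_unit e v v', subidem p e & a = v * p].
Proof.
move=> ee [ea ae]; have [s asa] := Rreg a.
have [a' a'E] : exists a', a' = e * s * e by exists (e * s * e).
have aa'a : a * a' * a = a by rewrite a'E !mulrA ae -!mulrA ea !mulrA.
have ea' : e * a' = a' by rewrite a'E !mulrA ee.
have a'e : a' * e = a' by rewrite a'E -!mulrA ee.
have [p pE] : exists p, p = a' * a by exists (a' * a).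
have [q qE] : exists q, q = a * a' by exists (a * a').
have [w' w'E] : exists w', w' = a' * q by exists (a' * q).
have pp : p * p = p by rewrite pE mulrA -(mulrA a') -(mulrA a') aa'a.
have qq : q * q = q by rewrite qE mulrA aa'a.
have pe : subidem p e by split; rewrite // pE ?mulrA ?ea' // -mulrA ae.
have qe : subidem q e by split; rewrite // qE ?mulrA ?ea // -mulrA a'e.
have ap : a * p = a by rewrite pE mulrA.
have qa : q * a = a by rewrite qE.
have pw' : p * w' = w' by rewrite w'E qE (mulrA a') -pE mulrA pp.
have w'q : w' * q = w' by rewrite w'E -mulrA qq.
have w'a : w' * a = p by rewrite w'E -mulrA qa pE.
have aw' : a * w' = q by rewrite w'E mulrA -qE qq.
have pq : idem_equiv p q by exists a, w'.
have [pp' ep' pe'] := subidemC ee pe; have [qq' eq' qe'] := subidemC ee qe.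
have [|x [x' [[qx xp px' x'q] [x'x xx']]]] := rk_equiv Rirr Rcont rkP pp' qq'.
  apply: (addrI (rk p)); rewrite -(subidem_rk rkP ee pe) (idem_equiv_rk rkP pq).
  by rewrite -(subidem_rk rkP ee qe).
have [_ ep pe0] := pe; have [_ eq qe0] := qe.
have w'x : w' * x = 0.
  by rewrite -qx -w'q -!mulrA (mulrA q) mulrBr qe0 qq subrr mul0r mulr0.
have x'a : x' * a = 0.
  by rewrite -x'q -qa -!mulrA (mulrA (e - q)) mulrBl eq qq subrr mul0r mulr0.
have ax' : a * x' = 0.
  by rewrite -px' -ap -!mulrA (mulrA p) mulrBr pe0 pp subrr mul0r mulr0.
have xw' : x * w' = 0.
  by rewrite -xp -pw' -!mulrA (mulrA (e - p)) mulrBl ep pp subrr mul0r mulr0.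
have xp0 : x * p = 0 by rewrite -xp -mulrA mulrBl ep pp subrr mulr0.
exists (a + x), (w' + x'), p; split=> //; last by rewrite mulrDl ap xp0 addr0.
split.
- split; rewrite ?mulrDr ?mulrDl; first by rewrite ea -qx mulrA eq'.
  by rewrite ae -xp -mulrA pe'.
- split; rewrite ?mulrDr ?mulrDl.
    by rewrite -pw' -px' !mulrA ep ep'.
  by rewrite -w'q -x'q -!mulrA qe0 qe'.
- by rewrite !mul_expand aw' ax' xw' xx'; nc.
- by rewrite !mul_expand w'a w'x x'a x'x; nc.
Qed.

(** One row operation makes the upper left block of [g] invertible, the Schur complement makes [g]
    block diagonal, and Whitehead's lemma moves the upper block into the corner of [f]. *)
Lemma elementary_reduction e f g g' : e * e = e -> f * f = f -> e * f = 0 ->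
  f * e = 0 -> idem_equiv e f -> corner_unit (e + f) g g' ->
  exists d d' u, [/\ corner_unit f d d', unipotent_prod (e + f) 9 u &
    g + (1 - e - f) = u * (d + (1 - f))].
Proof.
move=> ee ff ef fe [w [w' [[fw we ew' w'f] [w'w ww']]]] [[Eg gE] [Eg' g'E] gg' g'g].
have [a aE] : exists a, a = e * g * e by exists (e * g * e).
have [c cE] : exists c, c = f * g * e by exists (f * g * e).
have [b bE] : exists b, b = e * g' * f by exists (e * g' * f).
have [ea ae] : in_corner e a by split; rewrite aE ?mulrA ?ee // -mulrA ee.
have [v [v' [p [[[ev ve] [ev' v'e] vv' v'v] [pp ep pe] avp]]]] :=
  corner_unit_regular ee (conj ea ae).
have rel : e * g' * e * a + b * c = e.
  rewrite aE bE cE block_mul // g'g mulrDr mulrDl ee ef mul0r addr0 ee //.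
have ce : c * e = c by rewrite cE -mulrA ee.
have eb : e * b = b by rewrite bE !mulrA ee.
have bf : b * f = b by rewrite bE -mulrA ff.
(* [a] kills [e - p], so on that part the first block column of [g] is inverted through its lower
   entry [c] alone. *)
have bcp : b * c * (e - p) = e - p.
  have -> : b * c = e - e * g' * e * a by rewrite -{1}rel; nc.
  have ap : a * p = a by rewrite avp -mulrA pp.
  by rewrite !mul_expand ?(ee, ep, mulr_under ae, mulr_under ap); nc.
have [n nE] : exists n, n = (e - p) * b * c * p by exists ((e - p) * b * c * p).
have nn : n * n = 0.
  rewrite nE !mulrA -(mulrA _ p (e - p)) mulrBr pe pp subrr mulr0.
  by rewrite !mul0r.
have en : e * n = n by rewrite nE !mulrA mulrBr ee ep.
have ne : n * e = n by rewrite nE -mulrA pe.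
(* Adding [t] times the lower row turns the block [a = v p] into [v (p + (e - p) b c) = v (e + n)],
   a unit since [n] has square zero. *)
have [t tE] : exists t, t = v * (e - p) * b by exists (v * (e - p) * b).
have et : e * t = t by rewrite tE !mulrA ev.
have tf : t * f = t by rewrite tE -!mulrA bf.
have te : t * e = 0 by rewrite -tf -mulrA fe mulr0.
have ft : f * t = 0 by rewrite -et mulrA fe mul0r.
have tt : t * t = 0 by rewrite -{1}tf -mulrA ft mulr0.
have ct : in_corner (e + f) t.
  by split; rewrite ?mulrDr ?mulrDl ?et ?tf ?te ?ft ?addr0 ?add0r.
have [g1 g1E] : exists g1, g1 = (1 + t) * g by exists ((1 + t) * g).
have a1E : e * g1 * e = v * (e + n).
  have -> : e * g1 * e = a + t * c.
    rewrite g1E aE cE mulrDl mul1r mulrDr mulrDl; congr (_ + _).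
    by rewrite !mulrA et tf.
  rewrite avp tE -!mulrA -mulrDr; congr (_ * _).
  have <- : p + n + (e - p) = e + n by nc.
  rewrite nE -addrA; congr (_ + _).
  have E : (e - p) * (b * c * (e - p)) = e - p.
    by rewrite bcp !mul_expand ?(ee, pe, ep, pp); nc.
  rewrite -{3}E !mul_expand.
  have -> : p * b * c * e = p * b * c by rewrite -mulrA ce.
  have -> : e * b * c * e = e * b * c by rewrite -mulrA ce.
  by nc.
have g1c : corner_unit (e + f) g1 (g' * (1 - t)).
  have [Et tE'] := ct.
  have E1 : (e + f) * (1 + t) = (1 + t) * (e + f).
    by rewrite mulrDr [RHS]mulrDl mulr1 mul1r Et tE'.
  have E2 : (e + f) * (1 - t) = (1 - t) * (e + f).
    by rewrite mulrBr [RHS]mulrBl mulr1 mul1r Et tE'.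
  split.
  - by rewrite g1E; split; [rewrite mulrA E1 -mulrA Eg|rewrite -mulrA gE].
  - by split; [rewrite mulrA Eg'|rewrite -mulrA -E2 mulrA g'E].
  - rewrite g1E -!mulrA (mulrA g) gg' E2 mulrA.
    have -> : (1 + t) * (1 - t) = 1 - t * t by nc.
    by rewrite tt subr0 mul1r.
  - rewrite g1E !mulrA -(mulrA g'); have -> : (1 - t) * (1 + t) = 1 - t * t by nc.
    by rewrite tt subr0 mulr1 g'g.
have a1c : corner_unit e (e * g1 * e) ((e - n) * v').
  rewrite a1E; split.
  - by split; rewrite ?mulrA ?ev // -mulrA mulrDl ee ne.
  - by split; rewrite ?mulrA ?mulrBr ?ee ?en // -!mulrA v'e.
  - rewrite -mulrA (mulrA (e + n)).
    have -> : (e + n) * (e - n) = e.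
      by rewrite !mul_expand ee en ne nn; nc.
    by rewrite ev' vv'.
  - rewrite -mulrA (mulrA v') v'v !mul_expand ?(ee, en, ne, nn); nc.
have [d [d' [u [[[fd df] [fd' d'f] dd' d'd] uu uE]]]] :=
  schur_complement ee ff ef fe g1c a1c.
have wh := whitehead ee ff ef fe fw we ew' w'f w'w ww' a1c.
have [a1 a1E'] : exists a1, a1 = e * g1 * e by exists (e * g1 * e).
have [a1' a1'E] : exists a1', a1' = (e - n) * v' by exists ((e - n) * v').
rewrite -a1E' -a1'E in wh a1c uE.
case: a1c => [[ea1 a1e] [ea1' a1'e] aa' a'a].
exists (w * a1 * w' * d), (d' * w * a1' * w').
exists ((1 - t) * u * (a1 + w * a1' * w' + (1 - e - f))); split.
- split.
  + by split; rewrite ?mulrA ?fw // -!mulrA df.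
  + by split; rewrite ?mulrA ?fd' // -!mulrA w'f.
  + rewrite -!mulrA (mulrA d) dd' (mulrA f) fw (mulrA w') w'w (mulrA e) ea1'.
    by rewrite (mulrA a1) aa' ew' ww'.
  + rewrite -!mulrA (mulrA w') w'w (mulrA e) ea1 (mulrA a1') a'a (mulrA e) ew'.
    by rewrite (mulrA w) ww' fd d'd.
(* One transvection for the row operation, two for the Schur complement, six for Whitehead's
   lemma. *)
- rewrite -[9%N]/(1 + 2 + 6)%N; do !apply: unipotent_prodM => //.
  apply: unipotent_prod1; last by rewrite mulrN mulNr opprK.
  by case: ct => h1 h2; split; rewrite ?mulrN ?mulNr ?h1 ?h2.
have g0E : g + (1 - e - f) = (1 - t) * (g1 + (1 - e - f)).
  rewrite g1E !mul_expand tt te tf; nc.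
rewrite g0E uE -!mulrA; congr (_ * (_ * _)).
have a1f : a1 * f = 0 by rewrite -a1e -mulrA ef mulr0.
have a1w : a1 * w = 0 by rewrite -fw mulrA a1f mul0r.
have ew : e * w = 0 by rewrite -fw mulrA ef mul0r.
rewrite !mul_expand.
rewrite ?(a1w, ew, fw, a1f, ff, ef, ee, mulr_under w'w, mulr_under a1'e, mulr_under a'a,
  mulr_under ew', ww', we, mulr_under we, fd, mulr_under w'f).
by nc.
Qed.

End Generation.

(** * Infinite sums of elements of orthogonal corners *)

Section Sum.
Variables (R : pzRingType) (K : realType) (rk : R -> K).
Hypotheses (Rirr : irreducible_ring R) (Rcont : continuous_ring R).
Hypothesis rkP : rank_function rk.
Implicit Types a b c d e f p q w x y z : R.

Let Rreg : regular_ring R. Proof. by case: Rcont. Qed.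
Let Rcomp : complete_pideals R. Proof. by case: Rcont. Qed.
Let Rupper (C : set (pideal R)) (I : pideal R) : pideal_chain C ->
  pmeet I (psup C) = psup [set pmeet I J | J in C]%classic.
Proof. by case: Rcont => _ _ h _; exact: h. Qed.

Variable h : nat -> R.
Hypothesis hh : forall n, h n * h n = h n.
Hypothesis hS : forall n, subidem (h n.+1) (h n).
Hypothesis h_small : forall r : K, 0 < r -> exists n, rk (h n) < r.

Let E n := h n - h n.+1.

Lemma h_le m n : (m <= n)%N -> subidem (h n) (h m).
Proof.
elim: n => [|n IH]; first by rewrite leqn0 => /eqP->; split.
rewrite leq_eqVlt => /orP[/eqP->|/IH [_ mn nm]]; first by split.
have [nn1 n1 n2] := hS n; split=> //.
  by rewrite -n1 mulrA mn.
by rewrite -n2 -mulrA nm.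
Qed.

Lemma gap_corner n : in_corner (h 0) (E n).
Proof.
have [_ h1 h2] := h_le (leq0n n); have [_ h3 h4] := h_le (leq0n n.+1).
by split; rewrite ?mulrBr ?mulrBl ?h1 ?h2 ?h3 ?h4.
Qed.

Lemma gap_idem n : E n * E n = E n.
Proof. by have [] := subidemC (hh n) (hS n). Qed.

Lemma gap_orth m n : m <> n -> E m * E n = 0.
Proof.
have lt k l : (k < l)%N -> E k * E l = 0 /\ E l * E k = 0.
  move=> kl; have [_ k1 k2] := h_le (ltnW kl).
  have [_ l1 l2] := h_le (leqW (ltnW kl)); have [_ l3 l4] := h_le kl.
  have [_ m1 m2] := h_le (leqW kl).
  by rewrite !mul_expand ?(k1, k2, l1, l2, l3, l4, m1, m2); split; nc.
by case: (ltngtP m n) => // [/lt[]|/lt[]].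
Qed.

(** Killing the gaps forces [x h 0 = x h n] for every [n], and these ranks tend to zero. Elements
    below [h 0] are thus determined by their products with the gaps. *)
Lemma gap_sep x : (forall n, x * E n = 0) -> x * h 0 = 0.
Proof.
move=> xE; have xh n : x * h 0 = x * h n.
  elim: n => // n ->; have /eqP := xE n.
  by rewrite mulrBr subr_eq0 => /eqP.
apply: (rk_le0 rkP); rewrite leNgt; apply/negP => /h_small[n].
by rewrite ltNge (xh n) (rkMr rkP).
Qed.

(* The graphs of the partial sums, as right ideals of the orthogonal sum of
   [h 0 R] and [q R], form a chain whose supremum is the graph of the sum. *)
Lemma gap_sum q w w' (x : nat -> R) : q * h 0 = 0 -> h 0 * q = 0 ->
  q * w = w -> w * h 0 = w -> h 0 * w' = w' -> w' * q = w' -> w' * w = h 0 ->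
  (forall n, in_corner (E n) (x n)) ->
  exists s, in_corner (h 0) s /\ forall n, s * E n = x n /\ E n * s = x n.
Proof.
move=> qh hq qw wh hw' w'q w'w xE.
pose Y n := \sum_(i < n) x i.
have xEo m n : x m * E n = if m == n then x m else 0.
  case: eqP => [<-|mn]; first by have [] := xE m.
  by have [_ <-] := xE m; rewrite -mulrA gap_orth ?mulr0.
have YE n m : Y m * E n = if (n < m)%N then x n else 0.
  elim: m => [|m IH]; first by rewrite /Y big_ord0 mul0r.
  rewrite /Y big_ord_recr /= -/(Y m) mulrDl IH xEo ltnS.
  by case: (ltngtP n m) => [_|_|->]; rewrite ?addr0 ?add0r.
have sE n : h 0 - h n = \sum_(i < n) E i.
  elim: n => [|n IH]; first by rewrite big_ord0 subrr.
  by rewrite big_ord_recr /= -IH /E; nc.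
have Ys n m : (n <= m)%N -> Y m * (h 0 - h n) = Y n.
  move=> nm; rewrite sE mulr_sumr; apply: eq_bigr => i _.
  by rewrite YE (leq_trans (ltn_ord i) nm).
have hY n : h 0 * Y n = Y n.
  rewrite mulr_sumr; apply: eq_bigr => i _; have [<- _] := xE i.
  by rewrite mulrA; have [-> _] := gap_corner i.
have hs n : h 0 * (h 0 - h n) = h 0 - h n.
  by have [_ h1 _] := h_le (leq0n n); rewrite mulrBr hh h1.
have ss n m : (n <= m)%N -> (h 0 - h m) * (h 0 - h n) = h 0 - h n.
  move=> nm; have [_ m1 m2] := h_le (leq0n m); have [_ n1 n2] := h_le (leq0n n).
  have [_ nm1 nm2] := h_le nm.
  by rewrite mulrBr !mulrBl hh n1 m2 nm2; nc.
pose g n := (h 0 - h n) + w * Y n.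
pose C : set (pideal R) := fun J => exists n, J = principal (g n).
have gle n m : (n <= m)%N -> (principal (g n) <= principal (g m))%O.
  move=> nm; apply: le_principal; apply/principalP; exists (h 0 - h n).
  by rewrite mulrDl ss // -mulrA Ys.
have chC : pideal_chain C.
  move=> _ _ [n ->] [m ->]; case/orP: (leq_total n m) => nm; [left|right]; exact: gle.
have hw : h 0 * w = 0 by rewrite -qw mulrA hq mul0r.
have dC J : C J -> disj (principal q) J.
  move=> [n ->] z /principalP[y ->] /principalP[t E0].
  have := congr1 ( *%R (h 0)) E0.
  rewrite mulrA hq mul0r mulrA mulrDr hs mulrA hw mul0r addr0 => st.
  rewrite E0 mulrDl -st add0r -mulrA -(Ys n n) // -mulrA -st.
  by rewrite !mulr0.
have dG := disj_psup Rcomp Rupper chC dC.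
have [u Gu] := pideal_gen (psup C).
have ind y z : q * y = u * z -> q * y = 0.
  move=> yz; apply: dG; first by apply/principalP; exists y.
  by apply/Gu; exists z.
have [q1 [pi [[_ _ _ piq] [[q1q _] [piu _]]]]] := ortho_gen Rreg ind.
have piG n : pi * g n = g n.
  have : pideal_set (psup C) (g n).
    have /le_pidealP : (principal (g n) <= psup C)%O.
      by apply: psup_ub => //; exists n.
    by apply; apply/principalP; exists 1; rewrite mulr1.
  by move=> /Gu[y ->]; rewrite mulrA piu.
have piw : pi * w = 0 by rewrite -qw -q1q !mulrA piq !mul0r.
have pis n : pi * (h 0 - h n) = g n.
  by rewrite -[RHS]piG [RHS]mulrDr [pi * (w * _)]mulrA piw mul0r addr0.
have w's n : w' * (h 0 - h n) = 0 by rewrite -w'q -hs !mulrA -(mulrA w') qh mulr0 mul0r.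
have xs n : w' * pi * h 0 * (h 0 - h n) = Y n.
  by rewrite -mulrA hs -mulrA pis mulrDr w's add0r mulrA w'w hY.
(* [pi] lifts [h 0 - h n] to the generator [g n] of its graph, and [w'] reads off the second
   coordinate [Y n]. *)
exists (w' * pi * h 0).
have sP : in_corner (h 0) (w' * pi * h 0).
  by split; [rewrite !mulrA hw'|rewrite -mulrA hh].
have sEn n : w' * pi * h 0 * E n = x n.
  have -> : E n = (h 0 - h n.+1) - (h 0 - h n) by rewrite /E; nc.
  by rewrite mulrBr !xs /Y big_ord_recr /= addrAC subrr add0r.
split=> // n; split=> //.
have [_ sh] := sP.
apply/subr0_eq; rewrite -[x n](_ : x n * h 0 = x n); last first.
  by have [_ <-] := xE n; rewrite -mulrA; have [_ ->] := gap_corner n.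
rewrite -{1}sh mulrA -mulrBl; apply: gap_sep => m.
rewrite mulrBl -mulrA sEn xEo; case: eqP => [->|nm].
  by have [-> _] := xE m; rewrite subrr.
by have [<- _] := xE m; rewrite mulrA gap_orth // mul0r subr0.
Qed.

Variables (q w w' : R).
Hypotheses (qh : q * h 0 = 0) (hq : h 0 * q = 0) (qw : q * w = w)
  (wh : w * h 0 = w) (hw' : h 0 * w' = w') (w'q : w' * q = w') (w'w : w' * w = h 0).

(** The leading factors [1 + N n] are merged into [1 + s], where [s] restricts to [N n] on each gap
    and has square zero by [gap_sep]. The common length [k] allows induction on the factors. *)
Lemma unipotent_prod_sum k (x : nat -> R) :
  (forall n, unipotent_prod (E n) k (x n)) ->
  exists A, unipotent_prod (h 0) k A /\ forall n, A * E n = x n * E n.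
Proof.
elim: k x => [|k IH] x /= xE.
  by exists 1; split=> // n; rewrite xE.
have [N /choice[y NyP]] := choice xE.
have [A [Ak AE]] := IH y (fun n => let: And4 _ _ yk _ := NyP n in yk).
have Nc n : in_corner (E n) (N n) by case: (NyP n).
have [s [sh sE]] := gap_sum qh hq qw wh hw' w'q w'w Nc.
exists ((1 + s) * A); split.
  exists s, A; split=> //.
  have : s * s * h 0 = 0.
    apply: gap_sep => n; have [sn _] := sE n; have [Nn _] := Nc n.
    by rewrite -mulrA sn -Nn mulrA sn; case: (NyP n).
  by rewrite -mulrA (proj2 sh).
move=> n; have [_ _ yk ->] := NyP n; have [sn _] := sE n; have [_ Nn] := Nc n.
have yE := unipotent_prod_comm (gap_idem n) yk.
by rewrite -!mulrA AE -yE !mulrA !mulrDl !mul1r sn Nn.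
Qed.

End Sum.

(** * Generation by transvections *)

Section Swindle.
Variables (R : pzRingType) (K : realType) (rk : R -> K).
Hypotheses (Rirr : irreducible_ring R) (Rcont : continuous_ring R).
Hypotheses (rkP : rank_function rk) (Rnd : ~ rank_discrete rk).
Implicit Types a b c d e f g p q w x y z : R.

(** Reduction inside [e = p + q] leaves a unit [d] of the corner of [q], and [q] has the rank of
    [f]. Whitehead's lemma cancels [d] against a copy of its inverse in the corner of [f], so up to
    [9 + 6] transvections [g] equals [k]. *)
Lemma unit_shift e f g g' : e * e = e -> f * f = f -> e * f = 0 -> f * e = 0 ->
  rk e = rk f + rk f -> corner_unit e g g' ->
  exists k k', corner_unit f k k' /\
    unipotent_prod (e + f) 15 (g + k' + (1 - e - f)).
Proof.
move=> ee ff ef fe ref ge.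
have [p [pe ppe]] := halving Rirr Rcont rkP Rnd ee.
have qe := subidemC ee pe; have re := subidem_rk rkP ee pe.
have rpq := idem_equiv_rk rkP ppe.
have [q qE] : exists q, q = e - p by exists (e - p).
rewrite -qE in ppe qe re rpq.
have [pp ep pe'] := pe; have [qq eq qe'] := qe.
have pq : p * q = 0 by rewrite qE mulrBr pe' pp subrr.
have qp : q * p = 0 by rewrite qE mulrBl ep pp subrr.
have epq : p + q = e by rewrite qE; nc.
rewrite -epq in ge.
have [d [d' [u [du uu uE]]]] := elementary_reduction Rirr Rcont rkP pp qq pq qp ppe ge.
have rqf : rk q = rk f by move: ref; rewrite re rpq; lra.
have [w [w' [[fw wq qw' w'f] [w'w ww']]]] := rk_equiv Rirr Rcont rkP qq ff rqf.
have qf : q * f = 0 by rewrite -qe' -mulrA ef mulr0.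
have fq : f * q = 0 by rewrite -eq mulrA fe mul0r.
have [[qd dq] [qd' d'q] dd' d'd] := du.
have wh := whitehead qq ff qf fq fw wq qw' w'f w'w ww' du.
exists (w * d * w'), (w * d' * w'); split.
  split.
  - by split; rewrite ?mulrA ?fw // -mulrA w'f.
  - by split; rewrite ?mulrA ?fw // -mulrA w'f.
  - by rewrite -!mulrA (mulrA w') w'w (mulrA q) qd' (mulrA d) dd' qw' ww'.
  - by rewrite -!mulrA (mulrA w') w'w (mulrA q) qd (mulrA d') d'd qw' ww'.
have -> : g + w * d' * w' + (1 - e - f) = u * (d + w * d' * w' + (1 - q - f)).
  have E1 : e * (w * d' * w' - f) = 0.
    by rewrite mulrBr ef -fw !mulrA ef !mul0r subr0.
  have -> : g + w * d' * w' + (1 - e - f) = (g + (1 - p - q)) + (w * d' * w' - f).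
    by rewrite -epq; nc.
  rewrite uE -(unipotent_prod_id uu (y := w * d' * w' - f)); last by rewrite epq.
  by rewrite -mulrDr; congr (_ * _); nc.
rewrite -[15%N]/(9 + 6)%N; apply: unipotent_prodM.
  apply: unipotent_prod_sub uu; rewrite epq.
  by split; rewrite // !mul_expand ?(ee, ef, fe) addr0.
by apply: unipotent_prod_sub wh; split;
  rewrite !mul_expand ?(qq, ff, qf, fq, eq, qe', ef, fe); nc.
Qed.

(** A state [(h, k, g, g')] of the recursion: the unit [g], with inverse [g'], lives on the gap
    [h - k], and [k] is passed on as the next [h]. *)
Record stage (s : R * R * R * R) : Prop := {
  stage_h : s.1.1.1 * s.1.1.1 = s.1.1.1;
  stage_k : subidem s.1.1.2 s.1.1.1;
  stage_rk : rk s.1.1.1 = rk s.1.1.2 + rk s.1.1.2;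
  stage_unit : corner_unit (s.1.1.1 - s.1.1.2) s.1.2 s.2 }.

Definition stage_next (s t : R * R * R * R) : Prop :=
  [/\ stage t, t.1.1.1 = s.1.1.2 &
    unipotent_prod (s.1.1.1 - t.1.1.2) 15 (s.1.2 + t.2 + (1 - (s.1.1.1 - t.1.1.2)))].

Lemma stage_step s : stage s -> exists t, stage_next s t.
Proof.
case: s => [[[h k] g] g'] [/= hh kh rhk gu].
have [kk hk kh'] := kh.
have [p [pk kp]] := halving Rirr Rcont rkP Rnd kk.
have [qq kq qk] := subidemC kk pk; have rp := idem_equiv_rk rkP kp.
have rk' := subidem_rk rkP kk pk; have rh := subidem_rk rkP hh kh.
have [ee he eh] := subidemC hh kh.
have ek : (h - k) * k = 0 by rewrite mulrBl hk kk subrr.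
have ke : k * (h - k) = 0 by rewrite mulrBr kh' kk subrr.
have [|||u [u' [ku uu]]] := @unit_shift (h - k) (k - p) g g' ee qq _ _ _ gu.
- by rewrite -kq mulrA ek mul0r.
- by rewrite -qk -mulrA ke mulr0.
- move: rk' rh rp rhk; lra.
exists (k, p, u, u'); split=> //=.
  by split=> //=; rewrite rk' rp.
have E : h - k + (k - p) = h - p by nc.
have -> : g + u' + (1 - (h - p)) = g + u' + (1 - (h - k) - (k - p)) by nc.
by rewrite -E.
Qed.

Lemma corner_unit_unipotent s q w w' : stage s ->
  q * s.1.1.1 = 0 -> s.1.1.1 * q = 0 -> q * w = w -> w * s.1.1.1 = w ->
  s.1.1.1 * w' = w' -> w' * q = w' -> w' * w = s.1.1.1 ->
  unipotent_prod s.1.1.1 30 (s.1.2 + (1 - (s.1.1.1 - s.1.1.2))).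
Proof.
move=> st qh hq qw wh hw' w'q w'w.
(* Choice asks for a successor of every tuple, so [F] is arbitrary off the stages; its iterates from
   [s] remain stages. *)
have [F FP] : exists F : R * R * R * R -> R * R * R * R,
    forall t, stage t -> stage_next t (F t).
  have /choice[F FP] : forall t, exists u, stage t -> stage_next t u.
    move=> t; have [/stage_step[u tu]|nt] := pselect (stage t); first by exists u.
    by exists t => /nt.
  by exists F.
pose S n := iter n F s.
have Sst n : stage (S n) by elim: n => //= n /FP[].
have Snx n : stage_next (S n) (S n.+1) by exact: FP.
pose h n := (S n).1.1.1.
pose g n := (S n).1.2; pose g' n := (S n).2.
have hS n : (S n).1.1.2 = h n.+1 by rewrite /h; have [] := Snx n.
have hh n : h n * h n = h n := stage_h (Sst n).
have hsub n : subidem (h n.+1) (h n) by rewrite -hS; exact: stage_k (Sst n).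
have hrk n : rk (h n) = rk (h n.+1) + rk (h n.+1).
  by rewrite -hS; exact: stage_rk (Sst n).
have hle m n : (m <= n)%N -> subidem (h n) (h m) by exact: h_le.
have gu n : corner_unit (h n - h n.+1) (g n) (g' n).
  by rewrite -hS; exact: stage_unit (Sst n).
have xu n : unipotent_prod (h n - h n.+2) 15
    (g n + g' n.+1 + (1 - (h n - h n.+2))).
  by have [_ _] := Snx n; rewrite hS.
have small (r : K) : 0 < r -> exists n, rk (h n) < r.
  move=> r0.
  have rn n : rk (h n) * 2 ^+ n <= 1.
    elim: n => [|n IH].
      by rewrite mulr1; case/andP: (rank_bounds rkP (h 0%N)).
    apply: le_trans IH; by rewrite exprS mulrA mulr_natr mulr2n -hrk.
  have [n nr] : exists n : nat, r^-1 < 2 ^+ n.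
    by exists (Num.bound r^-1); apply: upper_nthrootP.
  exists n; have r2 : (0 : K) < 2 ^+ n by rewrite exprn_gt0.
  have := rn n; rewrite -ler_pdivlMr // mul1r => /le_lt_trans; apply.
  by rewrite -[r]invrK ltf_pV2 ?posrE ?invr_gt0.
have [e eE] : exists e : nat -> R, forall n, e n = h n - h n.+1.
  by exists (fun n => h n - h n.+1).
have ee n : e n * e n = e n by rewrite eE; apply: gap_idem.
have eo m n : m <> n -> e m * e n = 0 by move=> mn; rewrite !eE; apply: gap_orth.
have De n : h n - h n.+2 = e n + e n.+1 by rewrite !eE; nc.
have eg n : e n * g n = g n by rewrite eE; case: (gu n) => [[]].
have ge n : g n * e n = g n by rewrite eE; case: (gu n) => [[]].
have eg' n : e n * g' n = g' n by rewrite eE; case: (gu n) => [_ []].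
have g'e n : g' n * e n = g' n by rewrite eE; case: (gu n) => [_ []].
have gg' n : g n * g' n = e n by rewrite eE; case: (gu n).
have g'g n : g' n * g n = e n by rewrite eE; case: (gu n).
have blk X n : X * (h n - h n.+2) =
    (g n + g' n.+1 + (1 - (h n - h n.+2))) * (h n - h n.+2) ->
    X * e n = g n /\ X * e n.+1 = g' n.+1.
  have o1 : e n * e n.+1 = 0 by apply: eo => /eqP; rewrite ltn_eqF.
  have o2 : e n.+1 * e n = 0 by apply: eo => /esym/eqP; rewrite ltn_eqF.
  have g1 : g n * e n.+1 = 0 by rewrite -ge -mulrA o1 mulr0.
  have g2 : g' n.+1 * e n = 0 by rewrite -g'e -mulrA o2 mulr0.
  have D1 : (e n + e n.+1) * e n = e n by rewrite mulrDl ee o2 addr0.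
  have D2 : (e n + e n.+1) * e n.+1 = e n.+1 by rewrite mulrDl ee o1 add0r.
  rewrite De => XD; split.
    rewrite -[in LHS]D1 mulrA XD -mulrA D1 !mul_expand.
    by rewrite ?(ge, g2, ee, o2); nc.
  rewrite -[in LHS]D2 mulrA XD -mulrA D2 !mul_expand.
  by rewrite ?(g1, g'e, ee, o1); nc.
have small2 (k : nat -> nat) : (forall n, (n <= k n)%N) ->
    forall r : K, 0 < r -> exists n, rk (h (k n)) < r.
  move=> fn r /small[n nr]; exists n; apply: le_lt_trans nr.
  by apply: (rk_subidem_le rkP); apply: hle.
have [_ h01 h10] : subidem (h 1%N) (h 0%N) := hsub 0%N.
(* [A] acts as [g n] on even gaps and as [g' n] on odd ones. *)
have [A [Au AE]] : exists A, unipotent_prod (h 0%N) 15 A /\ forall n,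
    A * (h n.*2 - h n.*2.+2) =
    (g n.*2 + g' n.*2.+1 + (1 - (h n.*2 - h n.*2.+2))) * (h n.*2 - h n.*2.+2).
  apply: (@unipotent_prod_sum _ _ _ Rcont rkP (fun n => h n.*2) _ _ _ q w w') => //.
  - by move=> n; apply: hle; rewrite leq_double.
  - by apply: small2 => n; rewrite -addnn leq_addr.
(* [B] starts one gap later: it acts as [g n] on odd gaps and as [g' n] on even gaps other than the
   first. The auxiliary isomorphism is restricted to [h 1]. *)
have [B [Bu BE]] : exists B, unipotent_prod (h 1%N) 15 B /\ forall n,
    B * (h n.*2.+1 - h n.*2.+3) =
    (g n.*2.+1 + g' n.*2.+2 + (1 - (h n.*2.+1 - h n.*2.+3))) * (h n.*2.+1 - h n.*2.+3).
  apply: (@unipotent_prod_sum _ _ _ Rcont rkP (fun n => h n.*2.+1) _ _ _ q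
    (w * h 1%N) (h 1%N * w')) => //.
  - by move=> n; apply: hle; rewrite !ltnS leq_double.
  - by apply: small2 => n; rewrite -addnn; apply: leqW; rewrite leq_addr.
  - by rewrite /= -h01 mulrA [q * _]qh mul0r.
  - by rewrite /= -h10 -mulrA [_ * q]hq mulr0.
  - by rewrite mulrA qw.
  - by rewrite /= -mulrA hh.
  - by rewrite /= mulrA hh.
  - by rewrite -mulrA w'q.
  - by rewrite /= -mulrA (mulrA w') w'w [s.1.1.1 * _]h01 hh.
have e0 : e 0%N = s.1.1.1 - s.1.1.2 by rewrite eE -hS.
rewrite -e0 -[s.1.1.1]/(h 0%N) -[s.1.2]/(g 0%N).
have Bu0 := unipotent_prod_sub (hsub 0%N) Bu.
suff -> : g 0%N + (1 - e 0%N) = A * B.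
  by rewrite -[30%N]/(15 + 15)%N; apply: unipotent_prodM.
(* The two sides are compared gap by gap. On the first gap [B] is [1] and [A] is [g 0]; on later
   gaps [A] and [B] are mutually inverse; off [h 0] everything is [1]. *)
apply/subr0_eq; set c := _ - _.
have he0 : e 0%N * h 0%N = e 0%N by rewrite eE mulrBl hh h10.
have gh0 : g 0%N * h 0%N = g 0%N by rewrite -ge -mulrA he0.
have c1 : c * (1 - h 0%N) = 0.
  have h1 : h 0%N * (1 - h 0%N) = 0 by rewrite mulrBr mulr1 hh subrr.
  rewrite /c mulrBl -mulrA (unipotent_prod_id Bu0 h1) (unipotent_prod_id Au h1).
  by rewrite !mul_expand gh0 he0; nc.
have c0 : c * h 0%N = 0.
  apply: (gap_sep rkP small) => n; rewrite -eE mulrBl.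
  case: n => [|n].
    have -> : (g 0%N + (1 - e 0%N)) * e 0%N = g 0%N.
      by rewrite !mul_expand ge ee; nc.
    have h1e : h 1%N * e 0%N = 0 by rewrite eE mulrBr hh h10 subrr.
    have [Ae _] := blk _ _ (AE 0%N).
    by rewrite -mulrA (unipotent_prod_id Bu h1e) Ae subrr.
  have -> : (g 0%N + (1 - e 0%N)) * e n.+1 = e n.+1.
    by rewrite -(ge 0%N) !mul_expand -[_ * _ * e n.+1]mulrA eo //; nc.
  apply/eqP; rewrite subr_eq0 eq_sym; apply/eqP.
  rewrite -mulrA -[n]odd_double_half; case: (odd n); rewrite ?add1n ?add0n.
    have [_ ->] := blk _ _ (BE n./2).
    have [Ae _] := blk _ _ (AE n./2.+1).
    by rewrite -eg' mulrA Ae gg'.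
  have [-> _] := blk _ _ (BE n./2).
  have [_ Ae] := blk _ _ (AE n./2).
  by rewrite -eg mulrA Ae g'g.
by move: c1; rewrite mulrBr mulr1 c0 subr0.
Qed.

End Swindle.

(** * Square-zero elements and simplicity of the ring *)

Section NormalSubgroups.
Variables (R : pzRingType) (K : realType) (rk : R -> K).
Hypotheses (Rirr : irreducible_ring R) (Rcont : continuous_ring R).
Hypotheses (rkP : rank_function rk) (Rnd : ~ rank_discrete rk).
Implicit Types a b c d e f g p q w x y z : R.

Let Rreg : regular_ring R. Proof. by case: Rcont. Qed.

Definition inverse_pair x y := x * y = 1 /\ y * x = 1.

Lemma unipotent_inverse n : n * n = 0 -> inverse_pair (1 + n) (1 - n).
Proof. by move=> nn; split; rewrite !mul_expand nn; nc. Qed.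

(** Two reductions bring [g] into the corner of [t], one half of [q]. This is the gap of a stage
    starting at [q], and [p], orthogonal and equivalent to [q], is the free space in which the
    infinite sums are built. *)
Lemma unit_unipotent g g' : inverse_pair g g' -> exists k, unipotent_prod 1 k g.
Proof.
move=> [gg' g'g].
have [p [p1 pq]] := halving Rirr Rcont rkP Rnd (mul1r 1).
have [qq _ _] := subidemC (mul1r 1) p1.
have [q qE] : exists q, q = 1 - p by exists (1 - p).
rewrite -qE in pq qq; have [pp _ _] := p1.
have pq0 : p * q = 0 by rewrite qE mulrBr mulr1 pp subrr.
have qp0 : q * p = 0 by rewrite qE mulrBl mul1r pp subrr.
have pq1 : p + q = 1 by rewrite qE; nc.
have g1 : corner_unit (p + q) g g'.
  by rewrite pq1; split=> //; split; rewrite ?mul1r ?mulr1.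
have [d [d' [u [du uu uE]]]] := elementary_reduction Rirr Rcont rkP pp qq pq0 qp0 pq g1.
have [r [rq rqr]] := halving Rirr Rcont rkP Rnd qq.
have qr := subidemC qq rq; have [rr qr1 rq1] := rq; have [tt qt tq] := qr.
have rk_q := subidem_rk rkP qq rq; have rk_r := idem_equiv_rk rkP rqr.
have [t tE] : exists t, t = q - r by exists (q - r).
rewrite -tE in rqr qr tt qt tq rk_q rk_r.
have rt0 : r * t = 0 by rewrite tE mulrBr rq1 rr subrr.
have tr0 : t * r = 0 by rewrite tE mulrBl qr1 rr subrr.
have rtq : r + t = q by rewrite tE; nc.
rewrite -rtq in du.
have [c [c' [v [cv vv vE]]]] := elementary_reduction Rirr Rcont rkP rr tt rt0 tr0 rqr du.
have st : stage rk (q, r, c, c').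
  by split=> //=; [rewrite -rk_r in rk_q|rewrite -tE].
have [w [w' [[pw wq qw' w'p] [w'w _]]]] := idem_equiv_sym pq.
have := corner_unit_unipotent Rirr Rcont rkP Rnd st pq0 qp0 pw wq qw' w'p w'w.
rewrite /= -tE => cu.
have q1 : subidem q 1 by split; rewrite ?mul1r ?mulr1.
exists (9 + (9 + 30))%N.
have -> : g = u * (v * (c + (1 - t))).
  rewrite -vE -addrA -opprD rtq -uE.
  by rewrite -addrA -opprD pq1 subrr addr0.
apply: unipotent_prodM; first by rewrite -pq1.
by apply: unipotent_prodM; apply: unipotent_prod_sub q1 _; rewrite // -rtq.
Qed.

(** For [f = p + q] with [p] equivalent to [q], off-diagonal blocks have square zero, and a diagonal
    block such as [p z p = (p z w') w] is a product of two off-diagonal ones. *)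
Lemma square_zero_generate f (S : R -> Prop) : f * f = f ->
  (forall x y, S x -> S y -> S (x + y)) -> (forall x y, S x -> S y -> S (x * y)) ->
  (forall n, in_corner f n -> n * n = 0 -> S n) ->
  forall z, in_corner f z -> S z.
Proof.
move=> ff SD SM Sn z [fz zf].
have [p [pf pq]] := halving Rirr Rcont rkP Rnd ff.
have qf := subidemC ff pf; have [pp fp pf'] := pf; have [qq fq qf'] := qf.
have [q qE] : exists q, q = f - p by exists (f - p).
rewrite -qE in pq qf qq fq qf'.
have pq0 : p * q = 0 by rewrite qE mulrBr pf' pp subrr.
have qp0 : q * p = 0 by rewrite qE mulrBl fp pp subrr.
have [w [w' [[qw wp pw' w'q] [w'w ww']]]] := pq.
have off x y t : x * y = 0 -> y * x = 0 -> subidem x f -> subidem y f -> x * t = t ->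
    t * y = t -> S t.
  move=> xy yx [_ fx _] [_ _ yf] xt ty; apply: Sn.
    by split; [rewrite -xt mulrA fx|rewrite -ty -mulrA yf].
  by rewrite -{1}ty -mulrA -{2}xt (mulrA y) yx mul0r mulr0.
have Sw : S w by apply: (off q p).
have Sw' : S w' by apply: (off p q).
have -> : z = p * z * w' * w + p * z * q + (q * z * p + q * z * w * w').
  have pqf : p + q = f by rewrite qE; nc.
  rewrite -(mulrA _ w') w'w -(mulrA _ w) ww' -{1}fz -{1}zf -pqf; nc.
apply: (SD); apply: (SD).
- apply: SM => //; apply: (off p q) => //; first by rewrite !mulrA pp.
  by rewrite -mulrA w'q.
- by apply: (off p q) => //; [rewrite !mulrA pp|rewrite -mulrA qq].
- by apply: (off q p) => //; [rewrite !mulrA qq|rewrite -mulrA pp].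
- apply: SM => //; apply: (off q p) => //; first by rewrite !mulrA qq.
  by rewrite -mulrA wp.
Qed.

Lemma square_zero_idem n : n * n = 0 -> exists f, [/\ f * f = f, f * n = n & n * f = 0].
Proof.
move=> nn; have [f [[ff _ _] [fn [z fz]]]] := generatesP Rreg (mul1r 1) (mul1r n).
by exists f; split=> //; rewrite fz mulrA nn mul0r.
Qed.

(** The assumption for [e] and [1 - e] makes [g] commute with every idempotent. If [n] has square
    zero and [f] generates [n R], then [f] and [f + n] are idempotent, so [g] commutes with [n];
    such [n] generate the ring. *)
Lemma invariant_central g : (forall e, e * e = e -> (1 - e) * g * e = 0) ->
  forall z, g * z = z * g.
Proof.
move=> ge z; apply: (@square_zero_generate 1 (fun z => g * z = z * g)).
- exact: mul1r.
- by move=> x y gx gy; rewrite mulrDr mulrDl gx gy.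
- by move=> x y gx gy; rewrite mulrA gx -mulrA gy mulrA.
- move=> n _ nn.
  have comm e : e * e = e -> g * e = e * g.
    move=> ee; apply/subr0_eq.
    have -> : g * e - e * g = (1 - e) * g * e - (1 - (1 - e)) * g * (1 - e) by nc.
    by rewrite !ge ?subrr //; exact: idemC.
  have [f [ff fn nf]] := square_zero_idem nn.
  have h : g * (f + n) = (f + n) * g.
    by apply: comm; rewrite !mul_expand ff fn nf nn; nc.
  by move: h; rewrite mulrDr mulrDl comm // => /addrI.
- by split; rewrite ?mul1r ?mulr1.
Qed.

(** If [g] mapped the right ideals of both halves of [e] into themselves, it would map [e R] into
    itself. *)
Lemma noncentral_small g e : e * e = e -> (1 - e) * g * e <> 0 ->
  exists e', [/\ e' * e' = e', (1 - e') * g * e' <> 0 & rk e' + rk e' <= rk e].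
Proof.
move=> ee gne; have [p [pe pq]] := halving Rirr Rcont rkP Rnd ee.
have re := subidem_rk rkP ee pe; have rpq := idem_equiv_rk rkP pq.
have [qq eq qe] := subidemC ee pe; have [pp ep pe'] := pe.
have [p0|p0] := pselect ((1 - p) * g * p = 0); last first.
  by exists p; split=> //; rewrite re -rpq.
exists (e - p); split=> //; last by rewrite re -rpq.
move=> q0; apply: gne.
have gp : g * p = p * g * p.
  by apply/subr0_eq; rewrite -[RHS]p0; nc.
have gq : g * (e - p) = (e - p) * g * (e - p).
  by apply/subr0_eq; rewrite -[RHS]q0; nc.
have -> : (1 - e) * g * e = (1 - e) * (g * p) + (1 - e) * (g * (e - p)) by nc.
have h1 : (1 - e) * p = 0 by rewrite mulrBl mul1r ep subrr.
have h2 : (1 - e) * (e - p) = 0 by rewrite mulrBl mul1r eq subrr.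
by rewrite gp gq !mulrA h1 h2 !mul0r addr0.
Qed.

(** [p] generates [y R], which [y] kills. A right inverse [s] of [y] over [p] can therefore be
    chosen with [p s = 0], which makes [s y] orthogonal to [p]. *)
Lemma square_zero_frame y : y * y = 0 -> exists p q s,
  [/\ p * p = p, q * q = q, p * q = 0 & q * p = 0] /\ iso_pair q p y s.
Proof.
move=> yy; have [p [[pp _ _] [py [z pz]]]] := generatesP Rreg (mul1r 1) (mul1r y).
have yp : y * p = 0 by rewrite pz mulrA yy mul0r.
have [s sE] : exists s, s = (1 - p) * z * p by exists ((1 - p) * z * p).
have ys : y * s = p.
  by rewrite sE !mulrA mulrBr mulr1 yp subr0 -pz pp.
have ps : p * s = 0 by rewrite sE !mulrA mulrBr mulr1 pp subrr !mul0r.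
have sp : s * p = s by rewrite sE -mulrA pp.
exists p, (s * y), s; split; split=> //.
- by rewrite mulrA -(mulrA s) ys sp.
- by rewrite mulrA ps mul0r.
- by rewrite -mulrA yp mulr0.
- by split=> //; rewrite ?mulrA ?ys // -mulrA ys.
Qed.

(** Equal rank matches [p] with [p'] by some [w]; transport along [y] and [y'] matches [q] with
    [q'], and the complements match by rank. The sum of the three isomorphisms is the conjugating
    unit. *)
Lemma square_zero_conj y y' : y * y = 0 -> y' * y' = 0 -> rk y = rk y' ->
  exists u u', inverse_pair u u' /\ u * y * u' = y'.
Proof.
move=> yy yy' ryy.
have [p [q [s [[pp qq pq qp] [[py yq qs sp] [sy ys]]]]]] := square_zero_frame yy.
have [p' [q' [s' [[pp' qq' pq' qp'] [[py' yq' qs' sp'] [sy' ys']]]]]] :=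
  square_zero_frame yy'.
have rp : rk p = rk y.
  by apply: generates_rk => //; split=> //; exists s.
have rp' : rk p' = rk y'.
  by apply: generates_rk => //; split=> //; exists s'.
have rq : rk q = rk p by apply: (idem_equiv_rk rkP); exists y, s.
have rq' : rk q' = rk p' by apply: (idem_equiv_rk rkP); exists y', s'.
have [|w [w' [[pw wp pw' w'p] [w'w ww']]]] := rk_equiv Rirr Rcont rkP pp pp'.
  by rewrite rp rp'.
have v1 : iso_pair q q' (s' * w * y) (s * w' * y').
  split; split; rewrite ?mulrA ?qs' ?qs // -?mulrA ?yq ?yq' //.
    by rewrite (mulrA y') ys' (mulrA p') pw (mulrA w') w'w py sy.
  by rewrite (mulrA y) ys (mulrA p) pw' (mulrA w) ww' py' sy'.
have w1 : iso_pair p p' w w' by [].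
have sum a b : a * a = a -> b * b = b -> a * b = 0 -> b * a = 0 ->
    (a + b) * (a + b) = a + b.
  by move=> aa bb ab ba; rewrite !mul_expand aa bb ab ba; nc.
have ss := sum _ _ pp qq pq qp; have ss' := sum _ _ pp' qq' pq' qp'.
have pq1 := iso_pairD pq qp pq' qp' w1 v1.
have [|z [z' z1]] := rk_equiv Rirr Rcont rkP (idemC ss) (idemC ss').
  by rewrite !(rkC rkP) // !(rankD rkP) // rq rq' rp rp' ryy.
have cC a : a * a = a -> a * (1 - a) = 0 /\ (1 - a) * a = 0.
  by move=> aa; rewrite mulrBr mulrBl mulr1 mul1r aa subrr.
have [o1 o2] := cC _ ss; have [o1' o2'] := cC _ ss'.
have one a : a + (1 - a) = 1 by nc.
have [_ [uu' u'u]] := iso_pairD o1 o2 o1' o2' pq1 z1.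
exists (w + s' * w * y + z), (w' + s * w' * y' + z'); split.
  by split; rewrite ?uu' ?u'u.
have [[_ zc cz' _] _] := z1.
have yc : y * (1 - (p + q)) = 0.
  have qc : q * (1 - (p + q)) = 0 by rewrite mulrBr mulr1 mulrDr qp qq add0r subrr.
  by rewrite -yq -mulrA qc mulr0.
have yz' : y * z' = 0 by rewrite -cz' mulrA yc mul0r.
have cp : (1 - (p + q)) * p = 0 by rewrite mulrBl mul1r mulrDl pp qp addr0 subrr.
have cy : (1 - (p + q)) * y = 0 by rewrite -py mulrA cp mul0r.
have zp : z * p = 0 by rewrite -zc -mulrA cp mulr0.
have zy : z * y = 0 by rewrite -zc -mulrA cy mulr0.
have yp : y * p = 0 by rewrite -yq -mulrA qp mulr0.
have yw' : y * w' = 0 by rewrite -pw' mulrA yp mul0r.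
rewrite !mul_expand ?(zy, mulr_under yy, mulr_under yw', mulr_under yz',
  mulr_under ys, mulr_under yp, zp, wp, ww', py').
by nc.
Qed.

(** Simplicity of the ring as an induction principle. Let [p] generate [x R]. An idempotent of rank
    at most [n] times [rk p] decomposes into at most [n] idempotents equivalent to ones below [p],
    and for [n] above the inverse of [rk p] this covers [1]. *)
Lemma simple_ring_ind (Q : R -> Prop) x : x <> 0 ->
  (forall y z, Q y -> Q z -> Q (y + z)) -> (forall y z, Q (y * x * z)) ->
  forall z, Q z.
Proof.
move=> x0 QD Qx.
have [p [[pp _ _] [px [t pt]]]] := generatesP Rreg (mul1r 1) (mul1r x).
have rp : 0 < rk p.
  by apply: (rank_gt0 rkP) => p0; apply: x0; rewrite -px p0 mul0r.
have Qp y z : Q (y * p * z) by rewrite pt mulrA -[_ * t * z]mulrA.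
have Qh n h : h * h = h -> rk h <= rk p *+ n -> forall z, Q (h * z).
  elim: n h => [|n IH] h hh.
    rewrite mulr0n => /(rk_le0 rkP) -> z.
    by rewrite mul0r -(mulr0 (0 * p)).
  move=> hn z; have [hp|/ltW ph] := lerP (rk h) (rk p).
    have [q [[_ pq _] [w [w' [[qw wh _ _] [w'w _]]]]]] :=
      rk_compare Rirr Rcont rkP hh pp hp.
    by rewrite -w'w -qw -pq -!mulrA mulrA.
  have [q [qh [w [w' [[qw wp pw' w'q] [w'w ww']]]]]] :=
    rk_compare Rirr Rcont rkP pp hh ph.
  have rq : rk p = rk q by apply: (idem_equiv_rk rkP); exists w, w'.
  have -> : h * z = q * z + (h - q) * z by nc.
  apply: QD; first by rewrite -ww' -wp -!mulrA mulrA.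
  have [qq hq qh'] := subidemC hh qh; apply: IH => //.
  by move: hn; rewrite (subidem_rk rkP hh qh) mulrS rq lerD2l.
move=> z; rewrite -[z]mul1r.
apply: (Qh (Num.bound (rk p)^-1)); first exact: mul1r.
rewrite (rank1 rkP) -[leLHS](mulfV (lt0r_neq0 rp)) -mulr_natr.
rewrite ler_pM2l //; apply: ltW; apply: le_lt_trans (archi_boundP _).
  exact: lexx.
by rewrite invr_ge0 ltW.
Qed.

End NormalSubgroups.

(** * Normal subgroups *)

Section NormalSet.
Variables (R : pzRingType) (K : realType) (rk : R -> K).
Hypotheses (Rirr : irreducible_ring R) (Rcont : continuous_ring R).
Hypotheses (rkP : rank_function rk) (Rnd : ~ rank_discrete rk).
Implicit Types a b c d e f g p q w x y z : R.

Let Rreg : regular_ring R. Proof. by case: Rcont. Qed.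
Let Rcomp : complete_pideals R. Proof. by case: Rcont. Qed.
Let Rprime := prime_exists Rreg Rcomp Rirr.

(** [M] stands for a normal subgroup of the unit group, viewed as a set of ring elements. *)
Variable M : R -> Prop.
Hypothesis M1 : M 1.
Hypothesis MM : forall x y, M x -> M y -> M (x * y).
Hypothesis MV : forall x, M x -> exists x', inverse_pair x x' /\ M x'.
Hypothesis MJ : forall x u u', M x -> inverse_pair u u' -> M (u * x * u').

Lemma square_zeroN (n : R) : n * n = 0 -> (- n) * (- n) = 0.
Proof. by rewrite mulrN mulNr opprK. Qed.

Lemma transvectionV n : n * n = 0 -> M (1 + n) -> M (1 - n).
Proof.
move=> nn /MV[x' [[nx xn] Mx']]; have [_ h] := unipotent_inverse nn.
by have <- : x' = 1 - n by rewrite -[x']mul1r -[X in X * _]h -mulrA nx mulr1.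
Qed.

(* If [n = e x (1 - k)] where [k R] contains [e R], [g e R] and [g^-1 e R], then
   [g n g^-1] and [n] annihilate each other, so [[g, 1 + n] = 1 + g n g^-1 - n]. *)
Lemma normal_transvection g e : M g -> e * e = e -> (1 - e) * g * e <> 0 ->
  rk e + rk e + (rk e + rk e) <= 1 -> exists m, [/\ m <> 0, m * m = 0 & M (1 + m)].
Proof.
move=> Mg ee gne re; have [g' [[gg' g'g] Mg']] := MV Mg.
have re0 : 0 < rk e by apply: (rank_gt0 rkP) => e0; apply: gne; rewrite e0 mulr0.
have [s [ss se sge rs]] := rk_sum Rcont rkP e (g * e).
have [k [kk ks kge rk_k]] := rk_sum Rcont rkP s (g' * e).
(* [k] has rank at most three times that of [e], which is less than [1]. *)
have k1 : 1 - k <> 0.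
  move=> /subr0_eq k1; move: rk_k rs; rewrite -k1 (rank1 rkP).
  have := rkMr rkP g e; have := rkMr rkP g' e; lra.
have [x nx] := Rprime gne k1.
have [n nE] : exists n, n = e * x * (1 - k) by exists (e * x * (1 - k)).
have Ck t : k * t = t -> (1 - k) * t = 0 by move=> kt; rewrite mulrBl mul1r kt subrr.
have ke : (1 - k) * e = 0 by apply: Ck; rewrite -se mulrA ks.
have kg : (1 - k) * g * e = 0 by rewrite -mulrA; apply: Ck; rewrite -sge mulrA ks.
have kg' : (1 - k) * g' * e = 0 by rewrite -mulrA; apply: Ck.
have nn : n * n = 0 by rewrite {2}nE nE !mulrA -(mulrA _ _ e) ke mulr0 !mul0r.
have ngn : n * g * n = 0.
  by rewrite {2}nE nE !mulrA -(mulrA _ (1 - k)) -(mulrA _ _ e) kg mulr0 !mul0r.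
have ngn' : n * g' * n = 0.
  by rewrite {2}nE nE !mulrA -(mulrA _ (1 - k)) -(mulrA _ _ e) kg' mulr0 !mul0r.
have [m mE] : exists m, m = g * n * g' - n by exists (g * n * g' - n).
exists m; split.
- move=> m0; apply: nx.
  have gn : g * n = n * g.
    have gng : g * n * g' = n := subr0_eq (etrans (esym mE) m0).
    by rewrite -{2}gng -mulrA g'g mulr1.
  have -> : (1 - e) * g * e * x * (1 - k) = (1 - e) * (g * n) by rewrite nE; nc.
  by rewrite gn nE !mulrA mulrBl mul1r ee subrr !mul0r.
- have -> : m * m = g * n * (g' * g) * n * g' - g * (n * g' * n) - n * g * n * g' + n * n.
    by rewrite mE; nc.
  by rewrite g'g mulr1 (mulr_under nn) ngn ngn' nn; nc.
- have -> : 1 + m = g * ((1 + n) * g' * (1 - n)).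
    have -> : g * ((1 + n) * g' * (1 - n)) =
      g * g' - g * g' * n + g * n * g' - g * (n * g' * n) by nc.
    by rewrite gg' ngn' mE; nc.
  by apply: MM => //; apply: MJ => //; exact: unipotent_inverse.
Qed.

Lemma normal_corner f x : f * f = f -> f * x = x -> x * f = 0 -> x <> 0 ->
  M (1 + x) -> forall y, f * y = y -> y * f = 0 -> M (1 + y).
Proof.
move=> ff fx xf x0 Mx.
have D y z : f * y = y -> y * f = 0 -> f * z = z -> z * f = 0 ->
    M (1 + y) -> M (1 + z) -> M (1 + (y + z)).
  move=> fy yf fz zf My Mz; have yz : y * z = 0 by rewrite -fz mulrA yf mul0r.
  have -> : 1 + (y + z) = (1 + y) * (1 + z) by rewrite !mul_expand yz; nc.
  exact: MM.
have fg : f * (1 - f) = 0 by rewrite mulrBr mulr1 ff subrr.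
have gf : (1 - f) * f = 0 by rewrite mulrBl mul1r ff subrr.
have L z : in_corner f z -> forall y, f * y = y -> y * f = 0 -> M (1 + y) ->
    M (1 + z * y).
  move=> fz; suff [] : in_corner f z /\ forall y, f * y = y -> y * f = 0 ->
      M (1 + y) -> M (1 + z * y) by [].
  apply: (square_zero_generate Rirr Rcont rkP Rnd (S := fun z => in_corner f z /\
    forall y, f * y = y -> y * f = 0 -> M (1 + y) -> M (1 + z * y)) ff) => //.
  - move=> a b [ca Sa] [cb Sb]; split; first exact: in_cornerD.
    have [[fa _] [fb _]] := (ca, cb).
    move=> y fy yf My; rewrite mulrDl; apply: D; rewrite ?mulrA ?fa ?fb //.
    + by rewrite -mulrA yf mulr0.
    + by rewrite -mulrA yf mulr0.
    + exact: Sa.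
    + exact: Sb.
  - move=> a b [ca Sa] [cb Sb]; split; first exact: in_cornerM.
    have [fb _] := cb.
    move=> y fy yf My; rewrite -mulrA; apply: Sa; rewrite ?mulrA ?fb //.
      by rewrite -mulrA yf mulr0.
    exact: Sb.
  - move=> n [fn nf] nn; split=> // y fy yf My.
    have yn : y * n = 0 by rewrite -fn mulrA yf mul0r.
    have yy : y * y = 0 by rewrite -{2}fy mulrA yf mul0r.
    (* The commutator of [1 + n] and [1 + y] collapses because [y n = 0]. *)
    have -> : 1 + n * y = (1 + n) * (1 + y) * (1 - n) * (1 - y).
      by rewrite !mul_expand ?(nn, mulr_under nn, yn, mulr_under yn, yy,
        mulr_under yy); nc.
    apply: MM; last exact: transvectionV.
    by apply: MJ => //; exact: unipotent_inverse.
have Rr z : in_corner (1 - f) z -> forall y, f * y = y -> y * f = 0 ->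
    M (1 + y) -> M (1 + y * z).
  move=> fz; suff [] : in_corner (1 - f) z /\ forall y, f * y = y -> y * f = 0 ->
      M (1 + y) -> M (1 + y * z) by [].
  have cf a : in_corner (1 - f) a -> a * f = 0 by move=> [_ <-]; rewrite -mulrA gf mulr0.
  apply: (square_zero_generate Rirr Rcont rkP Rnd (S := fun z =>
    in_corner (1 - f) z /\ forall y, f * y = y -> y * f = 0 -> M (1 + y) ->
    M (1 + y * z)) (idemC ff)) => //.
  - move=> a b [ca Sa] [cb Sb]; split; first exact: in_cornerD.
    move=> y fy yf My; rewrite mulrDr; apply: D; rewrite ?mulrA ?fy //.
    + by rewrite -mulrA cf ?mulr0.
    + by rewrite -mulrA cf ?mulr0.
    + exact: Sa.
    + exact: Sb.
  - move=> a b [ca Sa] [cb Sb]; split; first exact: in_cornerM.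
    move=> y fy yf My; rewrite mulrA; apply: Sb; rewrite ?mulrA ?fy //.
      by rewrite -mulrA cf ?mulr0.
    exact: Sa.
  - move=> n cn nn; split=> // y fy yf My.
    have ny : n * y = 0 by rewrite -fy mulrA (cf _ cn) mul0r.
    have yy : y * y = 0 by rewrite -{2}fy mulrA yf mul0r.
    have -> : 1 + y * n = (1 - n) * (1 + y) * (1 - - n) * (1 - y).
      by rewrite !mul_expand ?(nn, mulr_under nn, ny, mulr_under ny, yy,
        mulr_under yy); nc.
    apply: MM; last exact: transvectionV.
    by apply: MJ => //; apply: unipotent_inverse; exact: square_zeroN.
move=> y fy yf.
have yg : y * (1 - f) = y by rewrite mulrBr mulr1 yf subr0.
have xg : x * (1 - f) = x by rewrite mulrBr mulr1 xf subr0.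
(* The middle [1] is the ring element to which [simple_ring_ind] is applied. *)
suff : M (1 + f * 1 * y) by rewrite mulr1 fy.
apply: (simple_ring_ind Rirr Rcont rkP (Q := fun z => M (1 + f * z * y)) x0)
  => [a b Ma Mb|a b].
  have -> : f * (a + b) * y = f * a * y + f * b * y by nc.
  by apply: D; rewrite // ?mulrA ?ff // -mulrA yf mulr0.
(* The product is regrouped so that [x] is multiplied on the left by the corner of [f] and on the
   right by the corner of [1 - f]. *)
have -> : f * (a * x * b) * y = (f * a * f) * (x * ((1 - f) * (b * y) * (1 - f))).
  have -> : (f * a * f) * (x * ((1 - f) * (b * y) * (1 - f))) =
    f * a * (f * (x * (1 - f)) * b * (y * (1 - f))) by nc.
  by rewrite xg fx yg !mulrA.
have cb : in_corner (1 - f) ((1 - f) * (b * y) * (1 - f)).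
  by split; rewrite !mulrA ?(idemC ff) // -(mulrA _ (1 - f) (1 - f)) idemC.
apply: L.
- by split; rewrite ?mulrA ?ff // -mulrA ff.
- by rewrite mulrA fx.
- by rewrite -!mulrA gf !mulr0.
- exact: Rr.
Qed.

(** [t] is an idempotent equivalent to [e] below a generator [p] of [y R]; since [t = t p] lies in
    [t y R], multiplying by [y] loses no rank. *)
Lemma rank_reduce f y e : f * y = y -> e * e = e -> rk e <= rk y ->
  exists t, rk (t * y) = rk e /\ f * (t * y) = t * y.
Proof.
move=> fy ee ey.
have [p [[pp _ _] gp]] := generatesP Rreg (mul1r 1) (mul1r y).
rewrite -(generates_rk rkP gp) in ey.
have [q [[qq pq qp] eq]] := rk_compare Rirr Rcont rkP ee pp ey.
have [_ [z pz]] := gp.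
exists q; split; last first.
  by rewrite -[q in LHS]pq {1}pz -!mulrA !mulrA fy -pz pq.
rewrite (idem_equiv_rk rkP eq); apply: le_anti; rewrite (rkMl rkP) /=.
by rewrite -{1}qp pz mulrA (rkMl rkP).
Qed.

Lemma normal_transvections g : M g -> (exists z, g * z <> z * g) ->
  forall n, n * n = 0 -> M (1 + n).
Proof.
move=> Mg [z gz] y yy.
have [e [ee ge]] : exists e, e * e = e /\ (1 - e) * g * e <> 0.
  apply: contrapT => h; apply: gz; apply: (invariant_central Rirr Rcont rkP Rnd).
  by move=> e ee; apply: contrapT => ge; apply: h; exists e.
(* Halving twice brings the rank down to at most a quarter, as [normal_transvection] asks. *)
have [e1 [ee1 ge1 re1]] := noncentral_small Rirr Rcont rkP Rnd ee ge.
have [e2 [ee2 ge2 re2]] := noncentral_small Rirr Rcont rkP Rnd ee1 ge1.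
have re : rk e <= 1 by case/andP: (rank_bounds rkP e).
have [|m [m0 mm Mm]] := normal_transvection Mg ee2 ge2; first by lra.
have [y0|y0] := pselect (y = 0); first by rewrite y0 addr0.
have [f [ff fm mf]] := square_zero_idem Rcont mm.
have [f' [ff' fy yf]] := square_zero_idem Rcont yy.
suff [y1 [y10 fy1 yf1 My1]] : exists y1,
    [/\ y1 <> 0, f' * y1 = y1, y1 * f' = 0 & M (1 + y1)].
  exact: (normal_corner ff' fy1 yf1 y10).
have nz (a b : R) : rk a = rk b -> b <> 0 -> a <> 0.
  move=> ab b0 a0; have := rank_gt0 rkP b0; rewrite -ab a0 (rk0 rkP); lra.
have conj a b : a * a = 0 -> b * b = 0 -> rk a = rk b -> M (1 + a) -> M (1 + b).
  move=> aa bb ab Ma; have [u [u' [[uu' u'u] <-]]] :=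
    square_zero_conj Rirr Rcont rkP aa bb ab.
  have -> : 1 + u * a * u' = u * (1 + a) * u' by rewrite mulrDr mulrDl mulr1 uu'.
  by apply: MJ.
have sq (a f0 : R) : f0 * a = a -> a * f0 = 0 -> a * a = 0.
  by move=> fa af; rewrite -{2}fa mulrA af mul0r.
(* The element of larger rank is cut down to the rank of the other, and the two are conjugate. If
   that is [y], then [t y] is the nonzero seed in its corner; if it is [m], then [normal_corner]
   first puts [1 + t m] into [M]. *)
case: (lerP (rk m) (rk y)) => [my|/ltW ym].
  have [p [[pp _ _] gp]] := generatesP Rreg (mul1r 1) (mul1r m).
  have rp := generates_rk rkP gp.
  have [|t [rt ft]] := rank_reduce fy pp; first by rewrite rp.
  have tf : t * y * f' = 0 by rewrite -mulrA yf mulr0.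
  exists (t * y); split=> //; first by apply: nz m0; rewrite rt.
  by apply: (conj m) => //; [exact: sq ft tf|rewrite rt rp].
have [p [[pp _ _] gp]] := generatesP Rreg (mul1r 1) (mul1r y).
have rp := generates_rk rkP gp.
have [|t [rt ft]] := rank_reduce fm pp; first by rewrite rp.
have tf : t * m * f = 0 by rewrite -mulrA mf mulr0.
exists y; split=> //; apply: (conj (t * m)) => //; first exact: sq ft tf.
  by rewrite rt rp.
exact: (normal_corner ff fm mf m0).
Qed.

Lemma normal_units g : M g -> (exists z, g * z <> z * g) ->
  forall u u', inverse_pair u u' -> M u.
Proof.
move=> Mg ncg u u' uu'; have MT := normal_transvections Mg ncg.
have [k] := unit_unipotent Rirr Rcont rkP Rnd uu'; elim: k u {uu'} => /= [u ->//|k IH u].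
by move=> [n [y [_ nn /IH My ->]]]; apply: MM => //; exact: MT.
Qed.

End NormalSet.

(** * Passage to the projective unit group *)

(** For [p] equivalent to [1 - p] through [w], commuting of [1 + w] and [1 + w'] would give
    [w w' = w' w], that is [1 - p = p], whence [p = 0] and [1 = 0]. *)
Lemma noncentral_unit (R : pzRingType) (K : realType) (rk : R -> K) :
  irreducible_ring R -> continuous_ring R -> rank_function rk ->
  ~ rank_discrete rk -> exists (u u' v v' : R),
  [/\ inverse_pair u u', inverse_pair v v' & u * v <> v * u].
Proof.
move=> Rirr Rcont rkP Rnd.
have [p [[pp _ _] pq]] := halving Rirr Rcont rkP Rnd (mul1r 1).
have [w [w' [[qw wp pw' w'q] [w'w ww']]]] := pq.
have pq0 : p * (1 - p) = 0 by rewrite mulrBr mulr1 pp subrr.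
have ww0 : w * w = 0 by rewrite -{2}qw -{1}wp mulrA -(mulrA w) pq0 mulr0 mul0r.
have ww0' : w' * w' = 0.
  by rewrite -{2}pw' -{1}w'q mulrA -(mulrA w') mulrBl mul1r pp subrr mulr0 mul0r.
exists (1 + w), (1 - w), (1 + w'), (1 - w').
split; [exact: unipotent_inverse|exact: unipotent_inverse|].
move=> E; have E1 : w * w' = w' * w.
  apply/subr0_eq; have -> : w * w' - w' * w = (1 + w) * (1 + w') - (1 + w') * (1 + w).
    by nc.
  by rewrite E subrr.
rewrite w'w ww' in E1.
have p0 : p = 0 by rewrite -pp -{2}E1 pq0.
case: Rirr => one _; apply: one.
by move: E1; rewrite p0 subr0.
Qed.

Theorem theorem1p2 (R : unitRingType) (K : realType) (rk : R -> K)
    (R_irreducible : irreducible_ring R)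
    (R_continuous : continuous_ring R)
    (rk_rank : rank_function rk)
    (R_nondiscrete : ~ rank_discrete rk) :
  simple_group (PGL R).
Proof.
have unitI (x y : R) : inverse_pair x y -> x \is a GRing.unit.
  by move=> [xy yx]; apply/unitrP; exists y.
have GLK (u : GL R) : inverse_pair (Defs.GLval u) (Defs.GLval u)^-1.
  by split; rewrite ?mulrV ?mulVr ?GLP.
pose nZ := center_normal (GL R).
split.
  have [u [u' [v [v' [uu vv uv]]]]] :=
    noncentral_unit R_irreducible R_continuous rk_rank R_nondiscrete.
  exists (coset nZ (MkGL (unitI _ _ uu))) => /esym/coset_eqP.
  rewrite invg1 mul1g => /(_ (MkGL (unitI _ _ vv))) /(congr1 val) /=.
  exact: uv.
move=> N nN.
case: (pselect (exists2 c, N c & c <> 1%g)) => [[c Nc c1]|h]; last first.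
  left; rewrite eqEsubset; split=> c /= Nc; last by rewrite Nc; exact: normal1 nN.
  by apply: contrapT => c1; apply: h; exists c.
(* [M] is the preimage of [N] in the unit group, as a set of ring elements. *)
right; pose M (x : R) := exists2 u : GL R, Defs.GLval u = x & N (coset nZ u).
have cM u v : coset nZ (u * v)%g = (coset nZ u * coset nZ v)%g :> PGL R.
  by rewrite -cosetM.
have cV u : coset nZ (u^-1)%g = ((coset nZ u)^-1)%g :> PGL R by rewrite -cosetV.
have M1 : M 1 by exists 1%g => //; exact: normal1 nN.
have MM x y : M x -> M y -> M (x * y).
  move=> [u <- Nu] [v <- Nv]; exists (u * v)%g => //.
  by rewrite cM; exact: normalM nN _ _ Nu Nv.
have MV x : M x -> exists x', inverse_pair x x' /\ M x'.
  move=> [u <- Nu]; exists (Defs.GLval u)^-1; split; first exact: GLK.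
  by exists (u^-1)%g => //; rewrite cV; exact: normalV nN _ Nu.
have MJ x v v' : M x -> inverse_pair v v' -> M (v * x * v').
  move=> [u <- Nu] vv; pose V := MkGL (unitI _ _ vv).
  exists (V * u * V^-1)%g.
    rewrite /=; congr (_ * _); apply: (can_inj (mulKr (unitI _ _ vv))).
    by rewrite (proj1 vv) mulrV ?(unitI _ _ vv).
  rewrite !cM cV -{1}[coset nZ V]invgK; exact: normalJ nN _ _ Nu.
have cc : coset nZ (repr c) = c by rewrite /coset reprK.
(* A nontrivial class has a representative outside the center of the unit group, which in particular
   fails to commute with some ring element. *)
have ncg : exists z, Defs.GLval (repr c) * z <> z * Defs.GLval (repr c).
  apply: contrapT => hz; apply: c1; rewrite -cc; apply/esym/coset_eqP.
  rewrite invg1 mul1g => v; apply/val_inj => /=; apply: contrapT => ne.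
  by apply: hz; exists (Defs.GLval v).
have Mc : M (Defs.GLval (repr c)) by exists (repr c); rewrite ?cc.
rewrite eqEsubset; split=> // d _.
have [u uE Nu] := normal_units R_irreducible R_continuous rk_rank R_nondiscrete
  M1 MM MV MJ Mc ncg (GLK (repr d)).
have <- : coset nZ u = d by rewrite (val_inj uE) /coset reprK.
exact: Nu.
Qed.
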